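(* Let $c\in\{0,N\}$ and let $[x_k]=(x_0,x_1,\ldots,x_N)$ be a nonsingular Gaussian sequence of $\mathbb{R}^d$-valued random vectors, with covariance matrix $C$ (the covariance matrix of the stacked vector $(x_0',x_1',\ldots,x_N')'$, partitioned into $(N+1)\times(N+1)$ blocks of size $d\times d$). Then $[x_k]$ is $CM_c$ if and only if $C^{-1}$ has the $CM_c$ form, i.e., $C^{-1}$ is a $CM_L$ matrix when $c=N$ and a $CM_F$ matrix when $c=0$.
   Context: All random vectors are defined on a common probability space $(\Omega,\mathcal{A},P)$. Notation: $[i,j]=\{i,i+1,\ldots,j\}$, $[x_k]_i^j=\{x_k: k\in[i,j]\}$ (empty if $i>j$), $[x_k]=[x_k]_0^N$, and $\sigma(\cdot)$ is the generated $\sigma$-field. $CM_c$ sequence: for $c\in\{0,N\}$, a sequence $[x_k]$ is $CM_c$ if for every $j\in[0,N]$, every $A\in\sigma([x_k]_{j+1}^N\setminus\{x_c\})$ and every $B\in\sigma([x_k]_0^{j-1}\setminus\{x_c\})$, $$P\{A\cap B\mid x_j,x_c\}=P\{A\mid x_j,x_c\}\,P\{B\mid x_j,x_c\}\quad\text{a.s.}$$ Here $[x_k]_a^b\setminus\{x_c\}$ means the subsequence with the index $c$ removed. Gaussian sequence: $x_0,\ldots,x_N$ are jointly Gaussian (the mean is not assumed to be zero); nonsingular: $C$ is nonsingular. $CM_L$ and $CM_F$ matrices: consider a symmetric positive definite matrix $M$ with $d\times d$ blocks $M_{i,j}$, $i,j\in[0,N]$. $M$ is called $CM_L$ if it has the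 form $$\begin{bmatrix} A_0 & B_0 & 0 & \cdots & 0 & 0 & D_0\\ B_0' & A_1 & B_1 & 0 & \cdots & 0 & D_1\\ 0 & B_1' & A_2 & B_2 & \cdots & 0 & D_2\\ \vdots & \vdots & \vdots & \vdots & \vdots & \vdots & \vdots\\ 0 & \cdots & 0 & B_{N-3}' & A_{N-2} & B_{N-2} & D_{N-2}\\ 0 & \cdots & 0 & 0 & B_{N-2}' & A_{N-1} & B_{N-1}\\ D_0' & D_1' & D_2' & \cdots & D_{N-2}' & B_{N-1}' & A_N \end{bmatrix},$$ that is, $M_{i,j}=0$ whenever $i,j\in[0,N-1]$ and $|i-j|>1$ (block tri-diagonal except for the last block row and last block column, which are arbitrary). $M$ is called $CM_F$ if it has the form $$\begin{bmatrix} A_0 & B_0 & D_2 & \cdots & D_{N-2} & D_{N-1} & D_N\\ B_0' & A_1 & B_1 & 0 & \cdots & 0 & 0\\ D_2' & B_1' & A_2 & B_2 & \cdots & 0 & 0\\ \vdots & \vdots & \vdots & \vdots & \vdots & \vdots & \vdots\\ D_{N-2}' & \cdots & 0 & B_{N-3}' & A_{N-2} & B_{N-2} & 0\\ D_{N-1}' & \cdots & 0 & 0 & B_{N-2}' & A_{N-1} & B_{N-1}\\ D_N' & 0 & 0 & \cdots & 0 & B_{N-1}' & A_N \end{bmatrix},$$ that is, $M_{i,j}=0$ whenever $i,j\in[1,N]$ and $|i-j|>1$ (block tri-diagonal except for the first block row and first block column, which are arbitrary). *)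

(* Defs.v *)
From HB Require Import structures.
From mathcomp Require Import all_boot all_order all_algebra.
From mathcomp Require Import all_classical all_reals all_analysis.
From mathcomp Require Import measurable_realfun.

Set Implicit Arguments.
Unset Strict Implicit.
Unset Printing Implicit Defensive.

Import Order.TTheory GRing.Theory Num.Theory.
Import numFieldNormedType.Exports.

Local Open Scope classical_set_scope.
Local Open Scope ring_scope.

Section conditional_probability.
Context (R : realType) (disp : measure_display) (T : measurableType disp)
  (P : probability T R).
Implicit Types (G : set (set T)) (A : set T).

(* f is a version of P(A | G), for a sub-sigma-field G of the events. *)
Definition cprob_version G A (f : T -> R) : Prop :=
  [/\ measurable_fun setT (f : g_sigma_algebraType G -> R),
      P.-integrable setT (EFin \o f) &
      forall E, G E -> (\int[P]_(w in E) (f w)%:E = P (A `&` E))%E].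

(* The version is chosen arbitrarily ([cprobP] shows that one exists); versions
   agree almost surely, so almost sure statements do not depend on the choice. *)
Definition cprob G A : T -> R :=
  xget (cst 0) [set f | cprob_version G A f].

Lemma Radon_Nikodym_pushforward disp' (Y : measurableType disp')
    (phi : {mfun T >-> Y}) A : measurable A ->
  exists f : Y -> R,
  [/\ measurable_fun setT f, P.-integrable setT (EFin \o (f \o phi)) &
    forall E, measurable E ->
      (\int[P]_(w in phi @^-1` E) (f (phi w))%:E = P (A `&` phi @^-1` E))%E].
Proof.
move=> mA.
have mphi : measurable_fun setT phi by [].
have PA : (P A < +oo)%E by rewrite -ge0_fin_numE// fin_num_measure.
pose mu := distribution P phi.
pose nu := pushforward (charge_of_finite_measure (mfrestr mA PA)) phi.
have numu : nu `<< mu.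
  apply/null_content_dominatesP => B mB muB0.
  have mB' : measurable (phi @^-1` B).
    by rewrite -[X in measurable X]setTI; exact: mphi.
  have mBA : measurable (phi @^-1` B `&` A) by exact: measurableI.
  apply: (subset_measure0 mBA mB' _ muB0); exact: subIsetl.
pose g0 := Radon_Nikodym nu mu; pose g : Y -> \bar R := g0 mphi.
have gfin w : g w \is a fin_num by exact: Radon_Nikodym_fin_num.
have intg : mu.-integrable setT g by exact: Radon_Nikodym_integrable.
have gfun E : measurable E -> nu E = (\int[mu]_(y in E) g y)%E.
  exact: Radon_Nikodym_integral.
have [mg intg_lty] := integrableP _ _ _ intg.
have mf : measurable_fun setT (fine \o g).
  apply/measurable_EFinP; rewrite [X in measurable_fun _ X](_ : _ = g)//.
  by apply/funext => w /=; rewrite fineK.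
have gE : EFin \o ((fine \o g) \o phi) = g \o phi.
  by apply/funext => w /=; rewrite fineK.
have intgP : P.-integrable setT (g \o phi).
  apply/integrableP; split; first exact: measurableT_comp mg mphi.
  apply: le_lt_trans intg_lty.
  rewrite [leRHS](ge0_integral_pushforward mphi)//.
  by apply: measurableT_comp => //; exact: mg.
exists (fine \o g); split => //; first by rewrite gE.
move=> E mE; have mE' : measurable (phi @^-1` E).
  by rewrite -[X in measurable X]setTI; exact: (mphi measurableT _ mE).
transitivity (\int[P]_(w in phi @^-1` E) (g \o phi) w)%E.
  by apply: eq_integral => w _; rewrite -gE.
rewrite -(@integral_pushforward _ _ _ _ _ _ mphi P E g mg _ mE); last first.
  exact: integrableS intgP.
by rewrite -gfun// setIC.
Qed.

Lemma cprobP G A :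
  sigma_algebra setT G -> G `<=` measurable -> measurable A ->
  cprob_version G A (cprob G A).
Proof.
move=> sG Gm mA.
suff [f Pf] : exists f, cprob_version G A f by exact: (xgetI _ Pf).
have mE : (measurable : set (set (g_sigma_algebraType G))) = G.
  exact: measurable_g_measurableTypeE.
pose phi : T -> g_sigma_algebraType G := idfun.
have mphi : measurable_fun setT phi.
  by move=> _ B; rewrite mE => /Gm mB; rewrite setTI.
pose Phi : {mfun T >-> g_sigma_algebraType G} := mfun_Sub (mem_set mphi).
have [f [mf intf fE]] := Radon_Nikodym_pushforward Phi mA.
by exists f; split => // E GE; apply: fE; rewrite mE.
Qed.

End conditional_probability.

Section gaussian_sequences.
Context (R : realType) (disp : measure_display) (T : measurableType disp)
  (P : probability T R) (N d : nat) (x : 'I_N.+1 -> {RV P >-> d.-tuple R}).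

(* The sigma-field generated by the random vectors x_k, k in K. *)
Definition sigma_seq (K : set 'I_N.+1) : set (set T) :=
  <<s \bigcup_(k in K) g_sigma_algebra_preimage (x k) >>.

Lemma sigma_seq_measurable K : sigma_seq K `<=` measurable.
Proof.
apply: smallest_sub; first exact: sigma_algebra_measurable.
move=> E [k _ [B mB <-]]; exact: (@measurable_funPT _ _ _ _ (x k)).
Qed.

Definition CM (c : 'I_N.+1) : Prop :=
  forall (j : 'I_N.+1) (A B : set T),
    sigma_seq [set k : 'I_N.+1 | (j < k)%N /\ k <> c] A ->
    sigma_seq [set k : 'I_N.+1 | (k < j)%N /\ k <> c] B ->
    {ae P, forall w,
      cprob P (sigma_seq [set j; c]) (A `&` B) w =
      cprob P (sigma_seq [set j; c]) A w * cprob P (sigma_seq [set j; c]) B w}.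

(* The case s = 0 is separate: [normal_prob m 0] is the uniform law on [0, 1],
   not the point mass at m. *)
Definition gaussian_law (m s : R) (B : set R) : \bar R :=
  if s == 0 then dirac m B else normal_prob m s B.

(* Every linear combination of the coordinates is Gaussian, possibly
   degenerate. *)
Definition jointly_gaussian : Prop :=
  forall a : 'I_N.+1 -> 'I_d -> R, exists m s : R,
    forall B : set R, measurable B ->
      P ((fun w => \sum_k \sum_i a k i * tnth (x k w) i) @^-1` B) =
      gaussian_law m s B.

(* [fine] loses nothing under [jointly_gaussian]: the covariances are finite. *)
Definition covmx : 'M[R]_(\sum_(k < N.+1) d) :=
  \mxblock_(i < N.+1, j < N.+1)
    (\matrix_(p < d, q < d)
      fine (covariance P (fun w => tnth (x i w) p) (fun w => tnth (x j w) q))).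

End gaussian_sequences.

Section CM_matrices.
Context (R : realType) (N d : nat).
Implicit Types (M : 'M[R]_(\sum_(k < N.+1) d)) (c : 'I_N.+1).

Definition posdefmx n (M : 'M[R]_n) : Prop :=
  M \is symmetricmx /\ forall v : 'rV[R]_n, v != 0 -> 0 < (v *m M *m v^T) 0 0.

Definition CM_L M : Prop :=
  posdefmx M /\
  forall i j : 'I_N.+1, (i < N)%N -> (j < N)%N -> (1 < `|i - j|)%N ->
    submxblock M i j = 0.

Definition CM_F M : Prop :=
  posdefmx M /\
  forall i j : 'I_N.+1, (0 < i)%N -> (0 < j)%N -> (1 < `|i - j|)%N ->
    submxblock M i j = 0.

Definition CM_form c M : Prop :=
  (c = ord_max -> CM_L M) /\ (c = ord0 -> CM_F M).

End CM_matrices.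

(* Main.v *)
(* For a fixed j, with S = {j, c}, U the indices above j and L those below j
   (both without c), the CM_c condition at j says that x_U and x_L are
   conditionally independent given x_S; for a nonsingular Gaussian vector this is
   equivalent to the vanishing of the (U, L) block of C^-1, and varying j yields
   exactly the blocks that a CM_c matrix must have zero.

   Both directions use that C^-1 is the covariance of C^-1 x, whose coordinates
   satisfy cov(C^-1 x, x) = 1.  If the (U, L) block vanishes, linear combinations
   of (C^-1 x)_U involve x_U and x_S only, are independent of (x_S, x_L), and
   together with x_S determine x_U.  Conversely, conditional independence makes
   any combination of (x_U, x_S) uncorrelated with x_S also uncorrelated with
   x_L.  Independence statements are reduced to E cos(Y + t) for Gaussian Y by a
   uniqueness theorem: an integrable function orthogonal to all cos(y + t), y in a
   linear space V of functions, has zero integral on every set of sigma(V). *)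
Require Import Defs.
From HB Require Import structures.
From mathcomp Require Import all_boot all_order all_algebra.
From mathcomp Require Import all_classical all_reals all_analysis.
From mathcomp Require Import measurable_realfun.
From mathcomp Require Import finmap ring lra zify.

Set Implicit Arguments.
Unset Strict Implicit.
Unset Printing Implicit Defensive.

Import Order.TTheory GRing.Theory Num.Theory.
Import numFieldNormedType.Exports.
Import HBNNSimple.

Local Open Scope classical_set_scope.
Local Open Scope ring_scope.

(** The hypothesis gives only the laws of single linear combinations; neither a joint density nor a
    Gaussian conditional law is at hand. Independence is therefore drawn from one formula, E cos(Y +
    t) = cos(m + t) exp(-s^2/2). Writing cos p cos q as a half-sum turns a product for the
    combinations a and b into terms for b + a and b - a, whose variances differ by four times the
    covariance. The formula itself comes from Stein's identity, obtained by integrating the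
    derivative of h times the normal density. Conditional probabilities are arbitrary versions, so
    conditional independence is used in integrated form: with q a version of P(B | G), the function
    1_B - q must integrate to zero over every set of the larger sigma-field. Test functions are kept
    bounded, so that products with an integrable function stay integrable and the passage from
    cosines to indicators needs only bounded limits. *)

Section bounded_measurable.
Context (R : realType) (disp : measure_display) (T : measurableType disp)
  (mu : {measure set T -> \bar R}).

Definition bounded_measurable (f : T -> R) : Prop :=
  measurable_fun setT f /\ exists K, forall w, `|f w| <= K.

Lemma bounded_measurable_cst r : bounded_measurable (cst r).
Proof. by split => //; exists `|r|. Qed.

Lemma bounded_measurableD f g : bounded_measurable f -> bounded_measurable g ->
  bounded_measurable (f \+ g).
Proof.
move=> [mf [K fK]] [mg [K' gK']]; split; first exact: measurable_funD.
exists (K + K') => w; apply: (le_trans (ler_normD _ _)).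
exact: lerD.
Qed.

Lemma bounded_measurableM f g : bounded_measurable f -> bounded_measurable g ->
  bounded_measurable (f \* g).
Proof.
move=> [mf [K fK]] [mg [K' gK']]; split; first exact: measurable_funM.
by exists (K * K') => w /=; rewrite normrM ler_pM.
Qed.

Lemma bounded_measurable_indic (A : set T) : measurable A ->
  bounded_measurable (\1_A).
Proof.
move=> mA; split; first exact: measurable_indic.
by exists 1 => w; rewrite indicE ger0_norm ?ler0n// lern1 leq_b1.
Qed.

Lemma bounded_measurable_cos (f : T -> R) : measurable_fun setT f ->
  bounded_measurable (cos \o f).
Proof.
move=> mf; split.
  by apply: measurableT_comp mf; apply: continuous_measurable_fun; exact: continuous_cos.
by exists 1 => w; rewrite /= ler_norml cos_geN1 cos_le1.
Qed.

Lemma integrable_mul f u : bounded_measurable f ->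
  mu.-integrable setT (EFin \o u) -> mu.-integrable setT (EFin \o (f \* u)).
Proof.
move=> [mf [K fK]] iu.
apply: (@integrableMr _ _ _ mu setT measurableT f (EFin \o u)) => //.
exists K; split; first exact: num_real.
by move=> M KM w _; exact: le_trans (fK w) (ltW KM).
Qed.

(** Dominated convergence with bound [K * |u|]. The measure is general because the lemma serves both
    for [P] and for Lebesgue measure. *)
Lemma cvg_Rintegral_mul (f_ : nat -> T -> R) (f u : T -> R) (K : R) :
  (forall n, measurable_fun setT (f_ n)) -> (forall n w, `|f_ n w| <= K) ->
  (forall w, f_ n w @[n --> \oo] --> f w) -> mu.-integrable setT (EFin \o u) ->
  \int[mu]_w (f_ n w * u w) @[n --> \oo] --> \int[mu]_w (f w * u w).
Proof.
move=> mf fK ff iu.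
have mu' : measurable_fun setT u by exact/measurable_EFinP/(measurable_int _ iu).
have mflim : measurable_fun setT f.
  by apply: (@measurable_fun_cvg _ _ _ _ f_) => // w _; exact: ff.
have [|||||if_ _ h] := @dominated_convergence _ T R mu setT measurableT
  (fun n => EFin \o (f_ n \* u)) (EFin \o (f \* u)) (fun w => (K * `|u w|)%:E).
- by move=> n; apply/measurable_EFinP; exact: measurable_funM.
- by apply/measurable_EFinP; exact: measurable_funM.
- apply: aeW => w _; apply/cvg_EFin; first by apply: nearW => n.
  by apply: cvgMl; exact: ff.
- have -> : (fun w => (K * `|u w|)%:E) = (fun w => K%:E * (`|EFin (u w)|))%E by [].
  apply: integrableZl => //; exact: integrable_abse iu.
- apply: aeW => w n _; rewrite lee_fin normrM.
  by rewrite ler_wpM2r.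
- apply: fine_cvg; rewrite fineK; first exact: h.
  exact: integrable_fin_num.
Qed.

End bounded_measurable.

(** * Multipliers of annihilators and the uniqueness theorem for cosines *)

Section multipliers.
Context (R : realType) (disp : measure_display) (T : measurableType disp)
  (P : probability T R).

Local Notation integrable u := (P.-integrable setT (EFin \o u)).

Lemma bounded_measurable_integrable f : bounded_measurable f -> integrable f.
Proof.
move=> bf; rewrite (_ : f = f \* cst 1); last by apply/funext => w /=; rewrite mulr1.
apply: integrable_mul => //.
exact: finite_measure_integrable_cst.
Qed.

(* The bounded functions preserving the annihilator of a family of test
   functions by multiplication form an algebra closed under bounded pointwise
   limits; this replaces a functional monotone class theorem. *)
Definition annihilator (F : set (T -> R)) (u : T -> R) : Prop :=
  integrable u /\ forall f, F f -> \int[P]_w (f w * u w) = 0.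

Definition multiplier (F : set (T -> R)) (h : T -> R) : Prop :=
  bounded_measurable h /\ forall u, annihilator F u -> annihilator F (h \* u).

Section multiplier_theory.
Variable F : set (T -> R).
Hypothesis bF : forall f, F f -> bounded_measurable f.

Lemma multiplier_cst r : multiplier F (cst r).
Proof.
split; first exact: bounded_measurable_cst.
move=> u [iu Fu]; split; first by apply: integrable_mul => //;
  exact: bounded_measurable_cst.
move=> f Ff /=; under eq_Rintegral do rewrite mulrCA.
rewrite RintegralZl ?Fu ?mulr0//.
by apply: (integrable_mul _ iu); exact: bF.
Qed.

Lemma multiplierD g h : multiplier F g -> multiplier F h -> multiplier F (g \+ h).
Proof.
move=> [bg Fg] [bh Fh]; split; first exact: bounded_measurableD.
move=> u Fu; have [igu gu] := Fg _ Fu; have [ihu hu] := Fh _ Fu.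
split.
  rewrite (_ : _ \* u = (g \* u) \+ (h \* u)); last first.
    by apply/funext => w /=; rewrite mulrDl.
  exact: (integrableD measurableT igu ihu).
move=> f Ff /=; under eq_Rintegral do rewrite mulrDl mulrDr.
rewrite RintegralD ?gu ?hu ?addr0//.
- by apply: (integrable_mul (bF Ff) igu).
- by apply: (integrable_mul (bF Ff) ihu).
Qed.

Lemma multiplierM g h : multiplier F g -> multiplier F h -> multiplier F (g \* h).
Proof.
move=> [bg Fg] [bh Fh]; split; first exact: bounded_measurableM.
move=> u /Fh /Fg; rewrite (_ : g \* (h \* u) = g \* h \* u)//.
by apply/funext => w /=; rewrite mulrA.
Qed.

Lemma multiplierZ r h : multiplier F h -> multiplier F (fun w => r * h w).
Proof. exact: multiplierM (multiplier_cst r). Qed.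

Lemma multiplier_sum n (h : 'I_n -> T -> R) :
  (forall i, multiplier F (h i)) -> multiplier F (fun w => \sum_i h i w).
Proof.
elim: n h => [|n ih] h Fh.
  by rewrite (_ : (fun _ => _) = cst 0) ?funeqE; [exact: multiplier_cst|move=> w;
    rewrite big_ord0].
rewrite (_ : (fun _ => _) = (fun w => \sum_(i < n) h (widen_ord (leqnSn n) i) w) \+ h
  ord_max).
  by apply: multiplierD => //; exact: ih.
by apply/funext => w; rewrite big_ord_recr.
Qed.

Lemma multiplierX n h : multiplier F h -> multiplier F (fun w => h w ^+ n).
Proof.
move=> Fh; elim: n => [|n ih].
  by rewrite (_ : (fun _ => _) = cst 1)//; exact: multiplier_cst.
rewrite (_ : (fun _ => _) = h \* (fun w => h w ^+ n)); last first.
  by apply/funext => w; rewrite exprS.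
exact: multiplierM.
Qed.

Lemma multiplier_cvg (h_ : nat -> T -> R) (h : T -> R) (K : R) :
  (forall n, multiplier F (h_ n)) -> (forall n w, `|h_ n w| <= K) ->
  (forall w, h_ n w @[n --> \oo] --> h w) -> multiplier F h.
Proof.
move=> Fh hK hh.
have mh : measurable_fun setT h.
  apply: (@measurable_fun_cvg _ _ _ _ h_) => [n|w _]; first by case: (Fh n) => [[]].
  exact: hh.
have bh : bounded_measurable h.
  split => //; exists K => w.
  have c : `|h_ n w| @[n --> \oo] --> `|h w| by apply: cvg_norm; exact: hh.
  rewrite -(cvg_lim _ c)//; apply: limr_le; first by apply/cvg_ex; exists `|h w|.
  exact: nearW.
split => // u Fu; have [iu _] := Fu; split; first exact: integrable_mul.
move=> f Ff /=.
have c := cvg_Rintegral_mul (fun n => (Fh n).1.1) hK hh (integrable_mul (bF Ff) iu).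
under eq_Rintegral do rewrite mulrCA.
rewrite -(cvg_lim _ c)//=.
rewrite (_ : (fun n => _) = cst 0) ?lim_cst//.
apply/funext => n; under eq_Rintegral do rewrite mulrCA.
exact: ((Fh n).2 _ Fu).2.
Qed.

(** The partial sums of the exponential series are polynomials in [h], hence multipliers, and are
    bounded by [expR K] when [|h| <= K]. *)
Lemma multiplier_expR h : multiplier F h -> multiplier F (expR \o h).
Proof.
move=> Fh; have [[_ [K hK]] _] := Fh.
apply: (@multiplier_cvg (fun n w => series (exp_coeff (h w)) n) _ (expR K)).
- move=> n; rewrite /series /=.
  rewrite (_ : (fun _ => _) = fun w => \sum_(i < n) i`!%:R^-1 * h w ^+ i).
    by apply: multiplier_sum => i; apply: multiplierZ; exact: multiplierX.
  by apply/funext => w; rewrite big_mkord; apply: eq_bigr => i _; rewrite mulrC.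
- move=> n w.
  have le1 : `|series (exp_coeff (h w)) n| <= series (exp_coeff `|h w|) n.
    rewrite -normed_series_exp_coeff; exact: ler_norm_sum.
  apply: (le_trans le1); apply: (@le_trans _ _ (expR `|h w|)); last by rewrite ler_expR.
  apply: nondecreasing_cvgn_le; last exact: is_cvg_series_exp_coeff.
  by apply: nondecreasing_series => i _ _; rewrite exp_coeff_ge0.
- by move=> w; exact: is_cvg_series_exp_coeff.
Qed.

Lemma multiplier_indicC (A : set T) : multiplier F \1_A -> multiplier F \1_(~` A).
Proof.
move=> FA; rewrite (_ : \1_(~` A) = cst 1 \+ (fun w => -1 * \1_A w)).
  by apply: multiplierD; [exact: multiplier_cst|exact: multiplierZ].
apply/funext => w /=; rewrite mulN1r !indicE in_setC.
by case: (w \in A); rewrite ?subrr ?subr0.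
Qed.

Lemma multiplier_indicI (A B : set T) :
  multiplier F \1_A -> multiplier F \1_B -> multiplier F \1_(A `&` B).
Proof. by move=> FA FB; rewrite indicI; exact: multiplierM. Qed.

(** Products give finite intersections. A countable union is the complement of the limit of the
    decreasing finite intersections of complements, so one bounded limit suffices and no
    disjointness argument arises. *)
Lemma multiplier_indic_sigma_algebra :
  sigma_algebra setT [set A : set T | measurable A /\ multiplier F \1_A].
Proof.
split.
- by split => //; rewrite indic0; exact: multiplier_cst.
- move=> A [mA FA]; split; first exact: measurableD.
  by rewrite setTD; exact: multiplier_indicC.
- move=> A_ AF; split; first by apply: bigcup_measurable => k _; case: (AF k).
  pose B n := \bigcap_(k < n) ~` A_ k.
  have FB n : multiplier F \1_(B n).
    elim: n => [|n ih].
      by rewrite /B bigcap_mkord big_ord0 indicT; exact: multiplier_cst.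
    rewrite (_ : B n.+1 = B n `&` ~` A_ n); last by rewrite /B !bigcap_mkord big_ord_recr.
    by apply: multiplier_indicI => //; apply: multiplier_indicC; case: (AF n).
  rewrite -[\bigcup_n A_ n]setCK setC_bigcup; apply: multiplier_indicC.
    apply: (@multiplier_cvg (fun n => \1_(B n)) _ 1) => //.
      by move=> n w; rewrite indicE ger0_norm ?ler0n// lern1 leq_b1.
    move=> w; have [Bw|nBw] := pselect ((\bigcap_n ~` A_ n) w).
      rewrite indicE mem_set//.
      rewrite (_ : (fun n => _) = cst 1); first exact: cvg_cst.
      by apply/funext => n; rewrite indicE mem_set// => k _; exact: Bw.
    rewrite indicE memNset//.
    have [k Ak] : exists k, A_ k w.
      by apply: contrapT => nA; apply: nBw => k _ Ak; apply: nA; exists k.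
    apply: cvg_near_cst; exists k.+1 => // n /= kn.
    by rewrite indicE memNset// => /(_ k kn).
Qed.

Lemma sub_multiplier_indic (E : set (set T)) :
  (forall A, E A -> measurable A /\ multiplier F \1_A) ->
  forall A, <<s E >> A -> measurable A /\ multiplier F \1_A.
Proof. by move=> EF; apply: smallest_sub => //; exact: multiplier_indic_sigma_algebra. Qed.

(** Adding [K] makes [h] nonnegative and bounded by [K + K]; it is then an increasing limit of
    simple functions, which are finite combinations of indicators of sets of [G]. *)
Lemma multiplier_measurable (G : set (set T)) (h : T -> R) :
  sigma_algebra setT G -> (forall A, G A -> measurable A /\ multiplier F \1_A) ->
  measurable_fun setT (h : g_sigma_algebraType G -> R) ->
  (exists K, forall w, `|h w| <= K) -> multiplier F h.
Proof.
move=> sG GF mh [K hK].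
have mE : (measurable : set (set (g_sigma_algebraType G))) = G.
  exact: measurable_g_measurableTypeE.
suff H : forall g : T -> R, measurable_fun setT (g : g_sigma_algebraType G -> R) ->
    (forall w, 0 <= g w <= K + K) -> multiplier F g.
  rewrite (_ : h = (fun w => h w + K) \+ cst (- K)); last first.
    by apply/funext => w /=; rewrite addrK.
  apply: multiplierD; last exact: multiplier_cst.
  apply: H; first exact: measurable_funD.
  by move=> w; move: (hK w); rewrite ler_norml -lerBlDr sub0r lerD2r.
move=> {h hK mh} g mg gK.
have mg' : measurable_fun setT (EFin \o (g : g_sigma_algebraType G -> R)).
  exact/measurable_EFinP.
have [|g_ [ndg gg]] := approximation measurableT mg'.
  by move=> w _; rewrite lee_fin; case/andP: (gK w).
pose h_ n : T -> R := g_ n.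
have hg w : h_ n w @[n --> \oo] --> g w.
  exact: (fine_cvg (gg w Logic.I)).
apply: (@multiplier_cvg h_ g (K + K)) => // [n|n w].
  rewrite (_ : h_ n = fun w : T =>
    \sum_(i < #|` fset_set (range (g_ n))|)
    ((fset_set (range (g_ n)))`_i * \1_(g_ n @^-1` [set (fset_set (range (g_ n)))`_i]) w)).
    apply: multiplier_sum => i; apply: multiplierZ.
    have m1 := measurable_funPTI (g_ n) (measurable_set1 (fset_set (range (g_ n)))`_i).
    by apply: (GF _ _).2; move: m1; set D := _ @^-1` _; rewrite [X in X D]mE.
  by apply/funext => w; rewrite /h_ fimfunEord.
have ndh : {homo h_^~ w : m n / (m <= n)%N >-> m <= n}.
  by move=> m p mp; have /lefP := ndg _ _ mp; exact.
have h0 : 0 <= h_ n w by exact: fun_ge0.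
rewrite ger0_norm//; apply: (@le_trans _ _ (g w)); last by case/andP: (gK w).
rewrite -(cvg_lim _ (hg w))//.
by apply: nondecreasing_cvgn_le => //; apply/cvg_ex; exists (g w); exact: hg.
Qed.

End multiplier_theory.

(** The product [h \* u] is again annihilated by [F], and 1 is one of the test functions. *)
Lemma annihilator_mul F h u :
  F (cst 1) -> multiplier F h -> annihilator F u -> \int[P]_w (h w * u w) = 0.
Proof.
move=> F1 [_ Fh] /Fh[_ /(_ _ F1)] <-.
by under [RHS]eq_Rintegral do rewrite mul1r.
Qed.

(** The indicator is the pointwise limit of exp(-n exp(n^2 g)), with values in [0, 1]. Where g < 0
    the inner term n exp(n^2 g) vanishes in the limit; where g >= 0 the value is at most exp(-n).
    The outer factor n is what settles the case g = 0. *)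
Lemma multiplier_lt0 F g : (forall f, F f -> bounded_measurable f) ->
  multiplier F g -> multiplier F \1_[set w | g w < 0].
Proof.
move=> bF Fg.
pose h n w := expR (- n.+1%:R * expR (n.+1%:R ^+ 2 * g w)).
have h1 n w : h n w <= 1.
  by rewrite -expR0 ler_expR mulNr oppr_le0 mulr_ge0// expR_ge0.
apply: (multiplier_cvg bF (h_ := h) (K := 1)) => [n|n w|w].
- apply: (multiplier_expR bF (h := fun w => _ * _)); apply: (multiplierZ bF).
  by apply: (multiplier_expR bF (h := fun w => _ * _)); apply: (multiplierZ bF).
- by rewrite ger0_norm// expR_ge0.
- rewrite indicE; case: (ltP (g w) 0) => gw.
    rewrite mem_set//.
    (* With delta = - g w and n for [n.+1]: 1 - h <= n exp(-n^2 delta) <= n / (n^2 delta) = 1 / (n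
       delta). *)
    apply: (@squeeze_cvgr _ _ _ _ (fun n => 1 - (- g w)^-1 * harmonic n) (cst 1)).
    + apply: nearW => n; rewrite h1 andbT.
      apply: le_trans (expR_ge1Dx _); rewrite lerD2l mulNr lerN2 -(opprK (g w)).
      set d := - g w; have d0 : 0 < d by rewrite oppr_gt0.
      rewrite mulrN expRN.
      have e : n.+1%:R ^+ 2 * d <= expR (n.+1%:R ^+ 2 * d).
        by apply: le_trans (expR_ge1Dx _); rewrite lerDr.
      rewrite ler_pdivrMr ?expR_gt0// opprK/=.
      apply: le_trans (ler_wpM2l _ e); last by rewrite mulr_ge0 ?invr_ge0// ltW.
      have := ltr0Sn R n; move: n.+1%:R => m m0.
      rewrite le_eqVlt; apply/orP; left; apply/eqP; field.
      by apply/andP; split; exact: lt0r_neq0.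
    + have : (1 - (- g w)^-1 * harmonic n) @[n --> \oo] --> 1 - (- g w)^-1 * 0.
        by apply: cvgB; [exact: cvg_cst|apply: cvgMr; exact: cvg_harmonic].
      by rewrite mulr0 subr0.
    + exact: cvg_cst.
  rewrite memNset; last by apply/negP; rewrite /= -leNgt.
  apply: (@squeeze_cvgr _ _ _ _ (cst 0) harmonic).
  + apply: nearW => n; rewrite expR_ge0/=.
    apply: (@le_trans _ _ (expR (- n.+1%:R))).
      rewrite ler_expR mulNr lerN2 ler_peMr// -expR0 ler_expR.
      by rewrite mulr_ge0// sqr_ge0.
    rewrite expRN lef_pV2 ?posrE ?expR_gt0//.
    by apply: le_trans (expR_ge1Dx _); rewrite lerDr.
  + exact: cvg_cst.
  + exact: cvg_harmonic.
Qed.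

Section trigonometric_test_functions.
Variable V : set (T -> R).
Hypothesis mV : forall y, V y -> measurable_fun setT y.
Hypothesis V0 : V (cst 0).
Hypothesis VD : forall y z, V y -> V z -> V (y \+ z).
Hypothesis VZ : forall r y, V y -> V (fun w => r * y w).

(** The phase [t] brings in the sines as well, so this real family plays the part of the characters
    exp(i y). *)
Definition cosines : set (T -> R) :=
  [set f | exists y t, V y /\ f = (fun w => cos (y w + t))].

Lemma cosines_bounded f : cosines f -> bounded_measurable f.
Proof.
move=> [y [t [Vy ->]]].
apply: (bounded_measurable_cos (f := fun w => y w + t)).
by apply: measurable_funD => //; exact: mV.
Qed.

Lemma cosines1 : cosines (cst 1).
Proof.
by exists (cst 0), 0; split => //; apply/funext => w /=; rewrite addr0 cos0.
Qed.

(** A product of two cosines is half the sum of the cosines of sum and difference of the arguments,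
    and [V] is a linear space. *)
Lemma multiplier_cos y t : V y -> multiplier cosines (fun w => cos (y w + t)).
Proof.
move=> Vy; have bc : bounded_measurable (fun w => cos (y w + t)).
  by apply: cosines_bounded; exists y, t.
split => // u [iu Vu]; split; first exact: integrable_mul.
move=> f [z [s [Vz ->]]].
have V1 : cosines (fun w => cos ((z \+ y) w + (s + t))).
  by exists (z \+ y), (s + t); split => //; exact: VD.
have V2 : cosines (fun w => cos ((z \+ (fun w => -1 * y w)) w + (s - t))).
  by eexists; exists (s - t); split; [|reflexivity]; apply: VD => //; exact: VZ.
transitivity (\int[P]_w (2^-1 * (cos ((z \+ y) w + (s + t)) * u w +
    cos ((z \+ (fun w => -1 * y w)) w + (s - t)) * u w))).
  apply: eq_Rintegral => w _ /=.
  rewrite (_ : z w + y w + (s + t) = (z w + s) + (y w + t)); last by ring.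
  rewrite (_ : z w + -1 * y w + (s - t) = (z w + s) - (y w + t)); last by ring.
  by rewrite (cosD (z w + s)) (cosB (z w + s)); field.
have i1 := integrable_mul (cosines_bounded V1) iu.
have i2 := integrable_mul (cosines_bounded V2) iu.
rewrite RintegralZl//; last exact: (integrableD measurableT i1 i2).
by rewrite RintegralD// !Vu// addr0 mulr0.
Qed.

(** The function sin((y - c) / n) is a cosine with phase shifted by pi/2. At a fixed point, as soon
    as n exceeds |y - c| the argument lies in ]-1, 1[, where the sine has the sign of y - c; the
    indicators of its negativity sets are thus eventually constant. *)
Lemma multiplier_cosines_lt y c : V y -> multiplier cosines \1_[set w | y w < c].
Proof.
move=> Vy; have bF := cosines_bounded.
pose g n w := sin (n.+1%:R^-1 * (y w - c)).
apply: (multiplier_cvg bF (h_ := fun n => \1_[set w | g n w < 0]) (K := 1)).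
- move=> n; apply: (multiplier_lt0 bF).
  rewrite (_ : g n = fun w => cos ((fun w => n.+1%:R^-1 * y w) w + (- n.+1%:R^-1 * c - pi
    / 2))).
    by apply: multiplier_cos; exact: VZ.
  apply/funext => w; rewrite /g addrA cosB cos_pihalf sin_pihalf mulr0 mulr1 add0r.
  by congr sin; ring.
- by move=> n w; rewrite indicE ger0_norm ?ler0n// lern1 leq_b1.
- move=> w; apply: cvg_near_cst.
  have [k] : exists k, `|y w - c| < k%:R.
    by exists (Num.bound `|y w - c|); exact: archi_boundP.
  move=> kw; exists k => // n /= kn.
  have n0 : 0 < n.+1%:R^-1 :> R by rewrite invr_gt0.
  have npi : n.+1%:R^-1 * `|y w - c| < pi.
    apply: (@lt_trans _ _ 1); last first.
      by apply: lt_le_trans (pi_ge2 R); rewrite ltr1n.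
    rewrite mulrC ltr_pdivrMr// mul1r; apply: (lt_le_trans kw).
    by rewrite ler_nat (leq_trans kn).
  rewrite !indicE; congr (_%:R); congr nat_of_bool.
  apply/idP/idP => /set_mem /= gw; apply/mem_set => /=; move: gw; rewrite /g.
    rewrite !ltNge; apply: contraNN => cy.
    have yc0 : 0 <= y w - c by rewrite subr_ge0.
    move: npi; rewrite ger0_norm// => npi; apply: sin_ge0_pi.
    by apply/andP; split; [apply: mulr_ge0 => //; exact: ltW|exact: ltW].
  move=> yc; have yc0 : y w - c < 0 by rewrite subr_lt0.
  move: npi; rewrite ltr0_norm// => npi.
  rewrite -(opprK (y w - c)) mulrN sinN oppr_lt0; apply: sin_gt0_pi.
  by rewrite mulr_gt0 ?oppr_gt0.
Qed.

(** For each y, the Borel sets whose preimage is good form a sigma-algebra; it contains the rays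
    ]-oo, c[, which generate. *)
Lemma cosines_sigma_algebra A : <<s \bigcup_(y in V) preimage_set_system setT y
  measurable >> A ->
  measurable A /\ multiplier cosines \1_A.
Proof.
apply: sub_multiplier_indic; first exact: cosines_bounded.
move=> {}A [y Vy [B mB <-]].
have y1 : sigma_algebra setT (image_set_system setT y
    [set A : set T | measurable A /\ multiplier cosines \1_A]).
  by apply: sigma_algebra_image; apply: multiplier_indic_sigma_algebra;
    exact: cosines_bounded.
have : <<s @RGenInftyO.G R >> `<=` image_set_system setT y
    [set A : set T | measurable A /\ multiplier cosines \1_A].
  apply: smallest_sub => // _ [c ->]; rewrite /image_set_system/= setTI.
  split; first by rewrite -[X in measurable X]setTI; exact: (mV Vy measurableT).
  rewrite (_ : y @^-1` _ = [set w | y w < c]); first exact: multiplier_cosines_lt.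
  by apply/seteqP; split => w /=; rewrite in_itv/=.
apply; change ((@RGenInftyO.G R).-sigma.-measurable B).
by rewrite -RGenInftyO.measurableE.
Qed.

End trigonometric_test_functions.

End multipliers.

(** * Stein's identity, moments and cosine transform of a normal law *)

Section normal_moments.
Context (R : realType) (m s : R).
Hypothesis s0 : s != 0.
Local Notation mu := lebesgue_measure.
Local Notation p := (normal_pdf m s).

(** The change of variables is available for the Radon-Nikodym derivative with respect to Lebesgue
    measure; this agrees almost everywhere with [p], both having the same integrals over measurable
    sets. *)
Lemma ge0_integral_normal_prob (f : R -> \bar R) :
  measurable_fun setT f -> (forall x, 0 <= f x)%E ->
  (\int[normal_prob m s]_x f x = \int[mu]_x (f x * (p x)%:E))%E.
Proof.
move=> mf f0.
have dom := normal_prob_dominates m s.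
have iN := Radon_Nikodym_SigmaFinite.f_integrable dom.
rewrite -(Radon_Nikodym_SigmaFinite.change_of_variables dom)//.
apply: ge0_ae_eq_integral => //.
- by apply: emeasurable_funM => //; exact: measurable_int iN.
- apply: emeasurable_funM => //; apply/measurable_EFinP; exact: measurable_normal_pdf.
- by move=> x _; rewrite mule_ge0//; exact: Radon_Nikodym_SigmaFinite.f_ge0.
- by move=> x _; rewrite mule_ge0// lee_fin normal_pdf_ge0.
apply: ae_eqe_mul2l; apply: integral_ae_eq => //.
- apply/measurable_EFinP; exact: measurable_normal_pdf.
- by move=> E _ mE; rewrite -Radon_Nikodym_SigmaFinite.f_integral.
Qed.

Lemma integrable_normal_prob (f : R -> R) : measurable_fun setT f ->
  mu.-integrable setT (EFin \o (f \* p)) ->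
  (normal_prob m s).-integrable setT (EFin \o f).
Proof.
move=> mf /integrableP[_ fp]; apply/integrableP; split; first exact/measurable_EFinP.
rewrite ge0_integral_normal_prob//; last by apply: measurableT_comp => //;
  exact/measurable_EFinP.
apply: le_lt_trans fp; rewrite le_eqVlt; apply/orP; left; apply/eqP;
  apply: eq_integral => x _ /=.
by rewrite -EFinM normrM (ger0_norm (normal_pdf_ge0 m s x)).
Qed.

Lemma integral_normal_prob (f : R -> R) : measurable_fun setT f ->
  mu.-integrable setT (EFin \o (f \* p)) ->
  (\int[normal_prob m s]_x (f x)%:E = \int[mu]_x (f x * p x)%:E)%E.
Proof.
move=> mf fp; have fN := integrable_normal_prob mf fp.
rewrite integralE [RHS]integralE; congr (_ - _)%E.
- rewrite ge0_integral_normal_prob//; last first.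
    by apply: measurable_funepos; exact/measurable_EFinP.
  apply: eq_integral => x _; rewrite !funeposE -EFin_max -EFinM -EFin_max; congr EFin.
  by rewrite maxr_pMl ?normal_pdf_ge0// mul0r.
- rewrite ge0_integral_normal_prob//; last first.
    by apply: measurable_funeneg; exact/measurable_EFinP.
  apply: eq_integral => x _; rewrite !funenegE -!EFinN -EFin_max -EFinM -EFin_max;
    congr EFin.
  by rewrite maxr_pMl ?normal_pdf_ge0// mul0r mulNr.
Qed.

(** With y = (x - m)^2 / (8 s^2), the density of deviation s is proportional to exp(-4y), that of
    deviation 2s to exp(-y), and y exp(-3y) <= 1. Quadratic growth is thereby dominated using only
    that normal densities are integrable. *)
Lemma normal_pdf_sqr_le x :
  (x - m) ^+ 2 * p x <= 8 * s ^+ 2 * normal_peak s / normal_peak (2 * s) * normal_pdf m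
    (2 * s) x.
Proof.
have s20 : 2 * s != 0 by rewrite mulf_neq0.
rewrite !normal_pdfE//.
have pk : 0 < normal_peak (2 * s) by rewrite normal_peak_gt0.
rewrite [leRHS]mulrA divfK ?gt_eqF//.
have ss : 0 < s ^+ 2 by rewrite exprn_even_gt0.
rewrite /normal_fun.
set y := (x - m) ^+ 2 / (8 * s ^+ 2).
have y0 : 0 <= y by rewrite divr_ge0// ?sqr_ge0// mulr_ge0// ltW.
have -> : - (x - m) ^+ 2 / (s ^+ 2 *+ 2) = - y + - (3 * y).
  by rewrite /y; field.
have -> : - (x - m) ^+ 2 / ((2 * s) ^+ 2 *+ 2) = - y.
  by rewrite /y; field.
have -> : (x - m) ^+ 2 = 8 * s ^+ 2 * y by rewrite /y; field.
rewrite expRD.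
have h : y * expR (- (3 * y)) <= 1.
  rewrite expRN ler_pdivrMr ?expR_gt0// mul1r.
  apply: le_trans (expR_ge1Dx _); lra.
set E := expR (- y); set E3 := expR _ in h *.
have -> : 8 * s ^+ 2 * y * (normal_peak s * (E * E3)) =
   8 * s ^+ 2 * normal_peak s * E * (y * E3) by ring.
rewrite -[leRHS]mulr1 ler_wpM2l//.
by rewrite mulr_ge0 ?expR_ge0// mulr_ge0 ?normal_peak_ge0// mulr_ge0// ltW.
Qed.

Lemma integrable_normal_growth (f : R -> R) K : measurable_fun setT f ->
  (forall x, `|f x| <= K * (1 + (x - m) ^+ 2)) ->
  mu.-integrable setT (EFin \o (f \* p)).
Proof.
move=> mf fK.
set c := 8 * s ^+ 2 * normal_peak s / normal_peak (2 * s).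
have i1 := integrableZl measurableT K (integrable_normal_pdf m s).
have i2 := integrableZl measurableT (K * c) (integrable_normal_pdf m (2 * s)).
have i := integrableD measurableT i1 i2.
apply: le_integrable i => //.
  apply/measurable_EFinP; apply: measurable_funM => //; exact: measurable_normal_pdf.
move=> x _ /=; rewrite lee_fin.
have K0 : 0 <= K.
  have := le_trans (normr_ge0 _) (fK m); by rewrite subrr expr0n/= addr0 mulr1.
apply: le_trans (ler_norm _); rewrite normrM (ger0_norm (normal_pdf_ge0 m s x)).
apply: (@le_trans _ _ (K * (1 + (x - m) ^+ 2) * p x)).
  by rewrite ler_wpM2r ?normal_pdf_ge0.
rewrite -mulrA mulrDl mul1r mulrDr lerD2l -[leRHS]mulrA ler_wpM2l//.
exact: normal_pdf_sqr_le.
Qed.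

Lemma is_derive_normal_pdf (x : R) : is_derive x (1 : R) p (- ((x - m) / s ^+ 2) * p x).
Proof.
rewrite normal_pdfE//.
suff h : is_derive x (1 : R) (fun x => normal_peak s * normal_fun m s x)
    (normal_peak s * (expR (- (x - m) ^+ 2 / (s ^+ 2 *+ 2)) * (- ((x - m) / s ^+ 2)))).
  by apply: is_derive_eq h _; rewrite /normal_fun; ring.
have h1 : is_derive x (1 : R) (fun x => - (x - m) ^+ 2 / (s ^+ 2 *+ 2)) (- ((x - m) / s
  ^+ 2)).
  rewrite (_ : (fun _ => _) = (fun x => (s ^+ 2 *+ 2)^-1 * (- (x - m) ^+ 2))); last first.
    by apply/funext => z; rewrite mulrC.
  apply: trigger_derive; rewrite /GRing.scale/=; field.
  done.
have h2 := @is_derive1_comp _ expR (fun x => - (x - m) ^+ 2 / (s ^+ 2 *+ 2)) x _ _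
  (is_derive_expR _) h1.
have h3 := @is_deriveZ _ _ _ _ (normal_peak s) x (1 : R) _ h2.
by apply: is_derive_eq h3 _.
Qed.

(** Stein's identity: the integrand is the derivative of h p. The fundamental theorem on
    [m - n, m + n] leaves boundary values that vanish as n grows. Suitable h give the mean, the
    variance and the differential equation of the cosine transform. *)
Lemma normal_stein (h h' : R -> R) K :
  (forall x : R, is_derive x (1 : R) h (h' x)) -> continuous h' ->
  (forall x, `|h x| <= K * (1 + `|x - m|)) -> (forall x, `|h' x| <= K) ->
  \int[mu]_x ((h' x - h x * ((x - m) / s ^+ 2)) * p x) = 0.
Proof.
move=> dh ch' hK h'K.
have ss : 0 < s ^+ 2 by rewrite exprn_even_gt0.
have K0 : 0 <= K by apply: le_trans (h'K m).
have ch : continuous h.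
  by move=> x; apply: differentiable_continuous; apply/derivable1_diffP; case: (dh x).
pose g x := h' x - h x * ((x - m) / s ^+ 2).
have cg : continuous g.
  move=> x; apply: cvgB; first exact: ch'.
  by apply: cvgM; [exact: ch|apply: cvgMl; apply: cvgB; [exact: cvg_id|exact: cvg_cst]].
have mg : measurable_fun setT g by exact: continuous_measurable_fun.
have ig : mu.-integrable setT (EFin \o (g \* p)).
  apply: (@integrable_normal_growth _ (K * (1 + 2 / s ^+ 2))) => // x.
  have q2 : `|x - m| <= 1 + (x - m) ^+ 2.
    rewrite -real_normK ?num_real//; have := sqr_ge0 (`|x - m| - 1); nra.
  apply: (le_trans (ler_normB _ _)); rewrite normrM normf_div (gtr0_norm ss).
  have -> : K * (1 + 2 / s ^+ 2) * (1 + (x - m) ^+ 2) =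
    K * (1 + (x - m) ^+ 2) + K * (2 * (1 + (x - m) ^+ 2)) / s ^+ 2 by ring.
  apply: lerD.
    by apply: (le_trans (h'K x)); rewrite ler_peMr// lerDl sqr_ge0.
  rewrite [leLHS]mulrA; apply: ler_wpM2r; first by rewrite invr_ge0 ltW.
  apply: (@le_trans _ _ (K * (1 + `|x - m|) * `|x - m|)).
    by rewrite ler_wpM2r.
  rewrite -mulrA ler_wpM2l//.
  move: q2; rewrite -(real_normK (num_real (x - m))); nra.
pose F x := h x * p x.
have dF (x : R) : is_derive x (1 : R) F (g x * p x).
  have dp := is_derive_normal_pdf x.
  have dF := @is_deriveM _ _ h p x (1 : R) _ _ (dh x) dp.
  by apply: is_derive_eq dF _; rewrite /GRing.scale/= /g; ring.
pose C := 8 * s ^+ 2 * normal_peak s.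
(* At distance n from m, h is at most 2 K n and p at most C / n^2, so h p is of order 1/n; here n
   stands for [n.+1], which is at least 1. *)
have FC (x : R) (n : nat) : `|x - m| = n.+1%:R -> `|F x| <= 2 * K * C * harmonic n.
  move=> xn; rewrite /F normrM (ger0_norm (normal_pdf_ge0 m s x)).
  have s20 : 2 * s != 0 by rewrite mulf_neq0.
  have p2 := normal_pdf_ub m x s20.
  have pk : 0 < normal_peak (2 * s) by rewrite normal_peak_gt0.
  have := normal_pdf_sqr_le x; rewrite -real_normK ?num_real// xn => pC.
  have {}pC : n.+1%:R ^+ 2 * p x <= C.
    apply: (le_trans pC); rewrite -/C -mulrA ler_piMr//.
      by rewrite mulr_ge0 ?normal_peak_ge0// mulr_ge0// ltW.
    by rewrite mulrC ler_pdivrMr// mul1r.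
  have := hK x; rewrite xn => hKn.
  have n0 : 1 <= n.+1%:R :> R by rewrite ler1n.
  move: n0 pC hKn; rewrite /=; move: n.+1%:R => N N1 pC hKn.
  have N0 : 0 < N by apply: lt_le_trans N1.
  apply: (@le_trans _ _ (K * (2 * N) * p x)).
    rewrite ler_wpM2r ?normal_pdf_ge0//; apply: (le_trans hKn).
    rewrite ler_wpM2l//; lra.
  rewrite ler_pdivlMr// [leLHS](_ : _ = 2 * K * (N ^+ 2 * p x)); last by ring.
  by rewrite ler_wpM2l// mulr_ge0.
pose I n : set R := `[m - n.+1%:R, m + n.+1%:R]%classic.
have FTC n : \int[mu]_x (\1_(I n) x * (g x * p x)) = F (m + n.+1%:R) - F (m - n.+1%:R).
  rewrite (_ : (fun x => _) = (g \* p) \_ (I n)); last first.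
    by rewrite patch_indic; apply/funext => x; rewrite mulrC.
  rewrite -Rintegral_mkcond /Rintegral (@continuous_FTC2 _ (g \* p) F)//.
  - by rewrite ltrBlDr -addrA ltrDl addr_gt0.
  - apply: continuous_subspaceT => x; apply: cvgM; first exact: cg.
    exact: continuous_normal_pdf.
  - have cF : continuous F.
      by move=> x; apply: differentiable_continuous; apply/derivable1_diffP; case: (dF x).
    split => [x _||]; first by case: (dF x).
      by apply: cvg_at_right_filter; exact: cF.
    by apply: cvg_at_left_filter; exact: cF.
  - by move=> x _; rewrite derive1E; apply: derive_val.
have I1 n w : `|\1_(I n) w| <= 1 :> R.
  by rewrite indicE ger0_norm ?ler0n// lern1 leq_b1.
have Icvg w : \1_(I n) w @[n --> \oo] --> (1 : R).
  apply: cvg_near_cst; exists (Num.bound `|w - m|) => // n /= xn.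
  rewrite indicE mem_set// /I /= in_itv/=.
  have : `|w - m| <= n.+1%:R.
    by apply: ltW; apply: lt_le_trans (archi_boundP (normr_ge0 _)) _;
      rewrite ler_nat (leq_trans xn).
  by rewrite ler_norml; lra.
have mI n : measurable_fun [set: measurableTypeR R] (\1_(I n) : measurableTypeR R -> R)
  by apply: measurable_indic; exact: measurable_itv.
have c1 := cvg_Rintegral_mul mI I1 Icvg ig.
have F0 (e : nat -> R) : (forall n, `|e n - m| = n.+1%:R) -> F (e n) @[n --> \oo] --> (0
  : R).
  move=> en; apply/norm_cvg0P.
  apply: (@squeeze_cvgr _ _ _ _ (cst 0) (fun n => 2 * K * C * harmonic n)).
  - by apply: nearW => n; rewrite normr_ge0/= FC.
  - exact: cvg_cst.
  - have : 2 * K * C * harmonic n @[n --> \oo] --> 2 * K * C * 0.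
      by apply: cvgMr; exact: cvg_harmonic.
    by rewrite mulr0.
have c2 : \int[mu]_x (\1_(I n) x * (g x * p x)) @[n --> \oo] --> (0 : R).
  under eq_fun do rewrite FTC.
  have : F (m + n.+1%:R) - F (m - n.+1%:R) @[n --> \oo] --> (0 - 0 : R).
    by apply: cvgB; apply: F0 => n; rewrite addrAC subrr add0r ?normrN normr_nat.
  by rewrite subrr.
rewrite -(cvg_lim (@Rhausdorff R) c2) (cvg_lim (@Rhausdorff R) c1).
by apply: eq_Rintegral => x _; rewrite mul1r.
Qed.

Lemma integrable_normal_moment (f : R -> R) K : measurable_fun setT f ->
  (forall x, `|f x| <= K * (1 + `|x - m|)) -> mu.-integrable setT (EFin \o (f \* p)).
Proof.
move=> mf fK; apply: (@integrable_normal_growth _ (2 * K)) => // x.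
have K0 : 0 <= K.
  have := le_trans (normr_ge0 _) (fK m); by rewrite subrr normr0 addr0 mulr1.
apply: (le_trans (fK x)); rewrite (mulrC 2) -mulrA ler_wpM2l//.
rewrite -real_normK ?num_real//; have := sqr_ge0 (`|x - m| - 1); nra.
Qed.

(** Stein's identity for h = 1. *)
Lemma normal_mean : \int[mu]_x ((x - m) * p x) = 0.
Proof.
have ss : s ^+ 2 != 0 by rewrite expf_neq0.
have := @normal_stein (cst 1) (cst 0) 1 _ _ _ _.
have i1 : mu.-integrable setT (EFin \o ((fun x => x - m) \* p)).
  apply: (@integrable_normal_moment _ 1); first exact: measurable_funB.
  by move=> x; rewrite mul1r lerDr.
have -> : \int[mu]_x ((cst 0 x - cst 1 x * ((x - m) / s ^+ 2)) * p x) =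
    \int[mu]_x (- (s ^+ 2)^-1 * ((x - m) * p x)).
  by apply: eq_Rintegral => x _ /=; ring.
rewrite RintegralZl// => H; apply: (mulfI (x := - (s ^+ 2)^-1)).
  by rewrite oppr_eq0 invr_eq0.
rewrite mulr0; apply: H => x.
- exact: cst_continuous.
- by rewrite /= normr1 mul1r lerDl.
- by rewrite /= normr0.
Qed.

(** Stein's identity for h = x - m. *)
Lemma normal_second_moment : \int[mu]_x ((x - m) ^+ 2 * p x) = s ^+ 2.
Proof.
have ss : s ^+ 2 != 0 by rewrite expf_neq0.
have H := @normal_stein (fun x => x - m) (cst 1) 1 _ _ _ _.
have i1 : mu.-integrable setT (EFin \o ((fun x => (x - m) ^+ 2) \* p)).
  apply: (@integrable_normal_growth _ 1).
    by apply: measurable_funX; exact: measurable_funB.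
  by move=> x; rewrite mul1r ger0_norm ?sqr_ge0// lerDr.
have i2 : mu.-integrable setT (EFin \o (fun x => (s ^+ 2)^-1 * ((x - m) ^+ 2 * p x))).
  exact: (integrableZl measurableT _ i1).
have {}H : \int[mu]_x (p x - (s ^+ 2)^-1 * ((x - m) ^+ 2 * p x)) = 0.
  rewrite -[RHS]H.
  - by apply: eq_Rintegral => x _ /=; field.
  - by move=> x; apply: trigger_derive; rewrite oppr0 addr0.
  - exact: cst_continuous.
  - by move=> x; rewrite mul1r lerDr.
  - by move=> x; rewrite /= normr1.
move: H; rewrite RintegralB//; last exact: integrable_normal_pdf.
rewrite RintegralZl// /Rintegral integral_normal_pdf/= => /eqP.
rewrite subr_eq0 => /eqP H; apply: (mulfI (x := (s ^+ 2)^-1)).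
  by rewrite invr_eq0.
by rewrite -H mulVf.
Qed.

(** Real form of the characteristic function of the centred law, at frequency [t] and phase [t0]. *)
Let G t0 t := \int[mu]_x (cos (t * (x - m) + t0) * p x).

Let cont_trig t t0 : continuous (fun x : R => cos (t * (x - m) + t0)) *
  continuous (fun x : R => sin (t * (x - m) + t0)).
Proof.
have c : continuous (fun x : R => t * (x - m) + t0).
  move=> x; apply: cvgD; last exact: cvg_cst.
  by apply: cvgMr; apply: cvgB; [exact: cvg_id|exact: cvg_cst].
split => x.
  exact: (@continuous_comp _ _ _ (fun x => t * (x - m) + t0) cos x (c x) (@continuous_cos
    _ _)).
exact: (@continuous_comp _ _ _ (fun x => t * (x - m) + t0) sin x (c x) (@continuous_sin _
  _)).
Qed.

(** Differentiation under the integral, dominated by |x - m| p, produces the integral of -(x - m)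
    sin(t (x - m) + t0) p; Stein's identity for that sine turns it back into a multiple of [G]. *)
Let is_deriveG t0 (t : R) : is_derive t (1 : R) (G t0) (- s ^+ 2 * t * G t0 t).
Proof.
have ss : s ^+ 2 != 0 by rewrite expf_neq0.
pose f (t x : R) := cos (t * (x - m) + t0) * p x.
have df (t' x : R) : is_derive t' (1 : R) (f ^~ x) (- ((x - m) * sin (t' * (x - m) + t0))
  * p x).
  have h1 : is_derive t' (1 : R) (fun t : R => t * (x - m) + t0) (x - m).
    by apply: trigger_derive; rewrite /GRing.scale/=; ring.
  have h2 := @is_derive1_comp _ cos (fun t : R => t * (x - m) + t0) t' _ _ (is_derive_cos
    _) h1.
  have h3 := @is_deriveZ _ _ _ _ (p x) t' (1 : R) _ h2.
  rewrite (_ : f ^~ x = (p x \*: (cos \o (fun t : R => t * (x - m) + t0)))).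
    by apply: is_derive_eq h3 _; rewrite /GRing.scale/=; ring.
  by apply/funext => z; rewrite /f mulrC.
have sinK t' x : `|sin (t' * (x - m) + t0)| <= 1.
  by rewrite ler_norml sin_geN1 sin_le1.
have bound x : 0 <= `|x - m| * p x by rewrite mulr_ge0// normal_pdf_ge0.
have ib : mu.-integrable setT (EFin \o (fun x => `|x - m| * p x)).
  apply: (@integrable_normal_moment (fun x => `|x - m|) 1).
    by apply: measurableT_comp => //; exact: measurable_funB.
  by move=> x; rewrite normr_id mul1r lerDr.
have intf t' : `]t - 1, t + 1[%classic t' -> mu.-integrable setT (EFin \o f t').
  move=> _; apply: (@integrable_normal_moment _ 1).
    by apply: continuous_measurable_fun; exact: (cont_trig _ _).1.
  by move=> x; rewrite mul1r (@le_trans _ _ 1)// ?ler_norml ?cos_geN1 ?cos_le1// lerDl.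
have derf t' x : `]t - 1, t + 1[%classic t' -> setT x -> derivable (f ^~ x) t' 1.
  by move=> _ _; case: (df t' x).
have pE t' x : partial1of2 f t' x = - ((x - m) * sin (t' * (x - m) + t0)) * p x.
  by rewrite partial1of2E; apply: derive_val.
have pb t' x : `]t - 1, t + 1[%classic t' -> setT x -> `|partial1of2 f t' x| <= `|x - m|
  * p x.
  move=> _ _; rewrite pE normrM normrN normrM (ger0_norm (normal_pdf_ge0 _ _ _)).
  by rewrite ler_wpM2r ?normal_pdf_ge0// ler_piMr.
have tI : `]t - 1, t + 1[%classic t by rewrite /= in_itv/= ltrBlDr ltrDl ltr01.
have d1 := derivable_under_integral measurableT tI intf derf bound ib pb.
have d2 := differentiation_under_integral measurableT tI intf derf bound ib pb.
apply: DeriveDef; first exact: d1.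
rewrite -derive1E [LHS]d2.
have i1 : mu.-integrable setT (EFin \o ((fun x => (x - m) * sin (t * (x - m) + t0)) \* p)).
  apply: (@integrable_normal_moment _ 1).
    apply: measurable_funM; first exact: measurable_funB.
    by apply: continuous_measurable_fun; exact: (cont_trig _ _).2.
  by move=> x; rewrite mul1r normrM (@le_trans _ _ `|x - m|)// ?lerDr// ler_piMr.
have i0 : mu.-integrable setT (EFin \o f t) by exact: intf.
have H := @normal_stein (fun x => sin (t * (x - m) + t0)) (fun x => t * cos (t * (x - m)
  + t0)) (1 + `|t|) _ _ _ _.
have {}H : \int[mu]_x (t * f t x - (s ^+ 2)^-1 * ((x - m) * sin (t * (x - m) + t0) * p
  x)) = 0.
  rewrite -[RHS]H.
  - by apply: eq_Rintegral => x _; rewrite /f; field.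
  - move=> x.
    have h1 : is_derive x (1 : R) (fun x : R => t * (x - m) + t0) t.
      by apply: trigger_derive; rewrite /GRing.scale/=; ring.
    have h2 := @is_derive1_comp _ sin (fun x : R => t * (x - m) + t0) x _ _
      (is_derive_sin _) h1.
    by apply: is_derive_eq h2 _; rewrite mulrC.
  - by move=> x; apply: cvgMr; exact: (cont_trig _ _).1.
  - move=> x; apply: (le_trans (sinK _ _)).
    by rewrite mulrDl mul1r -addrA lerDl addr_ge0// mulr_ge0// addr_ge0.
  - move=> x; rewrite normrM (@le_trans _ _ `|t|)// ?lerDr//.
    by rewrite ler_piMr// ler_norml cos_geN1 cos_le1.
have iz1 := integrableZl measurableT t i0.
have iz2 := integrableZl measurableT (s ^+ 2)^-1 i1.
move: H; rewrite RintegralB// RintegralZl// RintegralZl// => /eqP.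
rewrite subr_eq0 => /eqP H.
transitivity (\int[mu]_x (-1 * ((x - m) * sin (t * (x - m) + t0) * p x))).
  by apply: eq_Rintegral => x _; rewrite pE; ring.
rewrite RintegralZl//.
transitivity (- s ^+ 2 * ((s ^+ 2)^-1 * \int[mu]_x ((x - m) * sin (t * (x - m) + t0) * p
  x))).
  by field.
by rewrite -H /G; ring.
Qed.

(** By the differential equation, G(t) exp(s^2 t^2 / 2) is constant; its values at t = 1 and t = 0
    are compared, the mean being absorbed into the phase. *)
Lemma normal_cos t0 : \int[mu]_x (cos (x + t0) * p x) = cos (m + t0) * expR (- (s ^+ 2 /
  2)).
Proof.
pose E (t : R) := expR (s ^+ 2 / 2 * t ^+ 2).
have dE (t : R) : is_derive t (1 : R) E (s ^+ 2 * t * E t).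
  have h1 : is_derive t (1 : R) (fun t : R => s ^+ 2 / 2 * t ^+ 2) (s ^+ 2 * t).
    by apply: trigger_derive; rewrite /GRing.scale/=; field.
  have h2 := @is_derive1_comp _ expR (fun t : R => s ^+ 2 / 2 * t ^+ 2) t _ _
    (is_derive_expR _) h1.
  by apply: is_derive_eq h2 _; rewrite mulrC.
have dGE (t : R) : is_derive t (1 : R) (G (m + t0) * E) 0.
  have h := @is_deriveM _ _ (G (m + t0)) E t (1 : R) _ _ (is_deriveG _ _) (dE t).
  by apply: is_derive_eq h _; rewrite /GRing.scale/=; ring.
have e : G (m + t0) 1 * E 1 = G (m + t0) 0 * E 0 := is_derive_0_is_cst 1 0 dGE.
have G1 : G (m + t0) 1 = \int[mu]_x (cos (x + t0) * p x).
  by apply: eq_Rintegral => x _; congr (cos _ * _); ring.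
have G0 : G (m + t0) 0 = cos (m + t0).
  rewrite /G; under eq_Rintegral do rewrite mul0r add0r.
  rewrite RintegralZl//; last exact: integrable_normal_pdf.
  by rewrite /Rintegral integral_normal_pdf mulr1.
rewrite -G1 -G0 expRN; apply: (mulIf (lt0r_neq0 (expR_gt0 (s ^+ 2 / 2)))).
rewrite mulfVK ?lt0r_neq0 ?expR_gt0//.
by move: e; rewrite /E expr1n mulr1 expr0n/= mulr0 expR0 mulr1.
Qed.

End normal_moments.

(** * Integrals of a variable with a possibly degenerate Gaussian law *)

Section gaussian_law.
Context (R : realType) (disp : measure_display) (T : measurableType disp)
  (P : probability T R) (Y : {RV P >-> measurableTypeR R}) (m s : R).
Hypothesis Ylaw : forall B : set R, measurable B -> P (Y @^-1` B) = gaussian_law m s B.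
Local Notation mu := lebesgue_measure.

(** Quadratic growth covers the integrands of use: the identity, the squared deviation and the
    cosine. *)
Lemma gaussian_law_integral (f : R -> R) K :
  measurable_fun [set: measurableTypeR R] (f : measurableTypeR R -> R) ->
  (forall x, `|f x| <= K * (1 + (x - m) ^+ 2)) ->
  P.-integrable setT (EFin \o (f \o Y)) /\
  \int[P]_w f (Y w) =
    if s == 0 then f m else \int[mu]_x (f x * normal_pdf m s x).
Proof.
move=> mf fK.
have mfe : measurable_fun [set: measurableTypeR R] (EFin \o f) by exact/measurable_EFinP.
have mabs : measurable_fun [set: measurableTypeR R] (fun x => `|(f x)%:E|)%E.
  by apply: measurableT_comp mfe.
have mfY : measurable_fun setT (f \o Y) by exact: (measurableT_comp mf (measurable_funPT
  Y)).
have [s0|s0] := eqVneq s 0.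
  have D (g : measurableTypeR R -> \bar R) : (\int[distribution P Y]_x g x = \int[@dirac
    _ (measurableTypeR R) m R]_x g x)%E.
    apply: eq_measure_integral => A mA _.
    by have := Ylaw mA; rewrite /gaussian_law s0 eqxx.
  have i : P.-integrable setT (EFin \o (f \o Y)).
    apply/integrableP; split; first exact/measurable_EFinP.
    have := @ge0_integral_distribution _ _ _ _ _ P Y (fun x => `|(f x)%:E|)%E.
    move=> <-//.
    by rewrite D integral_dirac//= ?diracT ?mul1e ?ltry.
  split=> //; have e := @integral_distribution _ _ _ _ _ P Y (EFin \o f) mfe i.
  by rewrite /Rintegral -[X in fine X]e D integral_dirac// diracT mul1e.
have D (g : measurableTypeR R -> \bar R) : (\int[distribution P Y]_x g x =
  \int[normal_prob m s]_x g x)%E.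
  apply: eq_measure_integral => A mA _.
  by have := Ylaw mA; rewrite /gaussian_law (negbTE s0).
have ifp := integrable_normal_growth s0 mf fK.
have i : P.-integrable setT (EFin \o (f \o Y)).
  apply/integrableP; split; first exact/measurable_EFinP.
  have := @ge0_integral_distribution _ _ _ _ _ P Y (fun x => `|(f x)%:E|)%E.
  move=> <-//.
  by rewrite D; have /integrableP[] := integrable_normal_prob mf ifp.
split=> //; have e := @integral_distribution _ _ _ _ _ P Y (EFin \o f) mfe i.
by rewrite /Rintegral -[X in fine X]e D integral_normal_prob.
Qed.

Lemma gaussian_law_integrable : P.-integrable setT (EFin \o Y).
Proof.
apply: (@gaussian_law_integral id (1 + `|m|) _ _).1 => // x.
rewrite /= -[X in `|X|](subrK m); apply: (le_trans (ler_normD _ _)).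
have h : `|x - m| <= 1 + (x - m) ^+ 2.
  rewrite -real_normK ?num_real//; have := sqr_ge0 (`|x - m| - 1); nra.
rewrite mulrDl mul1r lerD// ler_peMr//; by rewrite lerDl sqr_ge0.
Qed.

Lemma gaussian_law_mean : \int[P]_w Y w = m.
Proof.
have [||i e] := @gaussian_law_integral (fun x => x - m) 1.
- exact: measurable_funB.
- move=> x; rewrite mul1r -real_normK ?num_real//; have := sqr_ge0 (`|x - m| - 1); nra.
have e0 : \int[P]_w (Y w - m) = 0.
  rewrite e; case: eqVneq => [_|s0]; first by rewrite subrr.
  exact: normal_mean.
have : \int[P]_w (Y w - m) = \int[P]_w Y w - \int[P]_w (cst m w).
  rewrite RintegralB//; first exact: gaussian_law_integrable.
  exact: finite_measure_integrable_cst.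
rewrite e0 Rintegral_cst//= probability_setT/= mulr1 => /eqP.
by rewrite eq_sym subr_eq0 => /eqP.
Qed.

Lemma gaussian_law_second_moment :
  P.-integrable setT (EFin \o (fun w => (Y w - m) ^+ 2)) /\
  \int[P]_w (Y w - m) ^+ 2 = s ^+ 2.
Proof.
have [||i e] := @gaussian_law_integral (fun x => (x - m) ^+ 2) 1.
- by apply: measurable_funX; exact: measurable_funB.
- by move=> x; rewrite mul1r ger0_norm ?sqr_ge0// lerDr.
split=> //; rewrite e; case: eqVneq => [->|s0].
  by rewrite subrr expr0n.
exact: normal_second_moment.
Qed.

Lemma gaussian_law_cos t :
  \int[P]_w cos (Y w + t) = cos (m + t) * expR (- (s ^+ 2 / 2)).
Proof.
have [||_ ->] := @gaussian_law_integral (fun x => cos (x + t)) 1.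
- have mt : measurable_fun setT (fun x : measurableTypeR R => x + t) by exact:
  measurable_funD.
  exact: (bounded_measurable_cos mt).1.
- move=> x; rewrite mul1r; apply: (@le_trans _ _ 1).
    by rewrite ler_norml cos_geN1 cos_le1.
  by rewrite lerDl sqr_ge0.
case: eqVneq => [->|s0]; last exact: normal_cos.
by rewrite expr0n/= mul0r oppr0 expR0 mulr1.
Qed.

End gaussian_law.

(** * Positive definite matrices *)

Section positive_definite.
Context (R : realType) (n : nat).
Implicit Types (C : 'M[R]_n) (v e : 'rV[R]_n).

Lemma symmetricmx_trmx C : C \is symmetricmx <-> C^T = C.
Proof.
split=> [/is_hermitianmxP|h].
  by rewrite expr0 scale1r map_mx_id// => <-.
by apply/is_hermitianmxP; rewrite expr0 scale1r map_mx_id.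
Qed.

Lemma posdefmx_unit C : posdefmx C -> C \in unitmx.
Proof.
move=> [_ pC]; rewrite -row_free_unit -kermx_eq0; apply/eqP/row_matrixP => i.
rewrite row0; apply/eqP; apply: contraT => /pC.
by rewrite -row_mul mulmx_ker row0 mul0mx mxE ltxx.
Qed.

Lemma posdefmx_inv C : posdefmx C -> posdefmx (invmx C).
Proof.
move=> pC; have uC := posdefmx_unit pC; case: pC => /symmetricmx_trmx sC pC.
have sC' : (invmx C)^T = invmx C by rewrite trmx_inv sC.
split; first exact/symmetricmx_trmx.
move=> v v0; have : v *m invmx C != 0.
  apply: contra v0 => /eqP vC0; apply/eqP.
  by rewrite -[v](mulmxKV uC) vC0 mul0mx.
by move=> /pC; rewrite mulmxKV// trmx_mul sC' mulmxA.
Qed.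

Lemma row_sqr_ge0 v : 0 <= (v *m v^T) 0 0.
Proof. by rewrite mxE sumr_ge0// => i _; rewrite mxE sqr_ge0. Qed.

Lemma row_sqr_eq0 v : (v *m v^T) 0 0 = 0 -> v = 0.
Proof.
rewrite mxE => /eqP; rewrite psumr_eq0; last by move=> i _; rewrite mxE sqr_ge0.
move=> /allP v0; apply/rowP => i; rewrite mxE.
by have := v0 i (mem_index_enum i); rewrite mxE mulf_eq0 orbb => /eqP.
Qed.

(** If v C v^T = 0 and w = v C, the form at t v + w is affine in t with slope 2 |w|^2; being
    nonnegative it has w = 0, and invertibility gives v = 0. *)
Lemma psdmx_unit_posdef C : C^T = C -> (forall v, 0 <= (v *m C *m v^T) 0 0) ->
  C \in unitmx -> posdefmx C.
Proof.
move=> sC pC uC; split; first exact/symmetricmx_trmx.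
move=> v v0; rewrite lt_def pC andbT; apply: contra v0 => /eqP vv.
suff : v *m C = 0 by move=> vC0; rewrite -[v](mulmxK uC) vC0 mul0mx.
apply: row_sqr_eq0; set w := v *m C; set c := (w *m w^T) 0 0.
have q t : (t *: v + w) *m C *m (t *: v + w)^T =
    t ^+ 2 *: (v *m C *m v^T) + t *: (w *m w^T) + t *: (w *m w^T) + w *m C *m w^T.
  have wE : w^T = C *m v^T by rewrite trmx_mul sC.
  rewrite linearD/= linearZ/= mulmxDl mulmxDr mulmxDl.
  rewrite -!scalemxAl -!scalemxAr scalerA -expr2 -/w mulmxDl !addrA.
  congr (_ + _); rewrite -addrA -[RHS]addrA; congr (_ + _).
  by rewrite addrC -scalemxAl -[w *m C *m v^T]mulmxA -wE.
apply/eqP; apply: contraT => c0.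
set D := (w *m C *m w^T) 0 0.
(* The value of t at which the affine function 2 c t + D equals -1. *)
have := pC ((- (D + 1) / (2 * c)) *: v + w).
have aE (A B : 'M[R]_1) : (A + B) 0 0 = A 0 0 + B 0 0 by rewrite mxE.
have zE t (A : 'M[R]_1) : (t *: A) 0 0 = t * A 0 0 by rewrite mxE.
rewrite q !aE !zE -/c -/D vv mulr0 add0r.
have -> : - (D + 1) / (2 * c) * c + - (D + 1) / (2 * c) * c + D = -1 by field.
by rewrite oppr_ge0 ler10.
Qed.

(* The principal submatrix of C on K is invertible; it is represented in full
   size by D C D + (1 - D), D being the coordinate projection onto K. *)
Lemma posdefmx_solve C (K : pred 'I_n) e : posdefmx C ->
  exists a : 'rV[R]_n, (forall i, ~~ K i -> a 0 i = 0) /\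
    (forall i, K i -> (a *m C) 0 i = e 0 i).
Proof.
move=> [sC pC].
pose D : 'M[R]_n := diag_mx (\row_i (K i)%:R).
have DE v i : (v *m D) 0 i = v 0 i * (K i)%:R by rewrite mul_mx_diag !mxE.
have DD : D *m D = D.
  rewrite /D mulmx_diag; congr diag_mx; apply/rowP => i; rewrite !mxE.
  by case: (K i); rewrite ?mulr1 ?mulr0.
have tD : D^T = D by rewrite tr_diag_mx.
pose E : 'M[R]_n := 1%:M - D.
pose M := D *m C *m D + E.
(* Commutation with the projection passes to the inverse of [M]; this is what makes the solution
   supported on [K]. *)
have MD : M *m D = D *m M.
  rewrite /M /E mulmxDl mulmxDr mulmxBl mulmxBr mul1mx mulmx1 DD !subrr !addr0.
  by rewrite -mulmxA DD !mulmxA DD.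
have uM : M \in unitmx.
  rewrite -row_free_unit -kermx_eq0; apply/eqP/row_matrixP => i.
  rewrite row0; set v := row i _.
  have vM : v *m M = 0 by rewrite /v -row_mul mulmx_ker row0.
  have EE : E *m E^T = E.
    rewrite /E linearB/= trmx1 tD mulmxBl mulmxBr mulmxBr mul1mx mulmx1 mul1mx DD.
    by rewrite subrr subr0.
  (* For v in the kernel, v M v^T = 0 splits into two nonnegative terms, the form of C at v D and
     the squared norm of v E, so both components vanish. *)
  have : (v *m D *m C *m (v *m D)^T) 0 0 + (v *m E *m (v *m E)^T) 0 0 = 0.
    have -> : v *m D *m C *m (v *m D)^T = v *m (D *m C *m D) *m v^T.
      by rewrite trmx_mul tD !mulmxA.
    have -> : v *m E *m (v *m E)^T = v *m E *m v^T.
      by rewrite trmx_mul !mulmxA -(mulmxA v) EE.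
    transitivity ((v *m M *m v^T) 0 0); last by rewrite vM mul0mx mxE.
    by rewrite /M (mulmxDr v _ E) (mulmxDl _ (v *m E)) [RHS]mxE.
  move=> H; have vD : v *m D = 0.
    apply/eqP; apply: contraT => /pC; have := row_sqr_ge0 (v *m E).
    by move: H; lra.
  move: H; rewrite vD !mul0mx mxE add0r => /row_sqr_eq0 vE.
  by rewrite -[v]mulmx1 -(subrK D 1%:M) mulmxDr vE vD addr0.
have VD : invmx M *m D = D *m invmx M.
  have := congr1 (fun A => invmx M *m A *m invmx M) MD.
  by rewrite /= mulKmx// mulmxA mulmxK// => ->.
pose a := e *m D *m invmx M.
have aD : a *m D = a by rewrite /a -!mulmxA VD (mulmxA D) DD.
exists a; split=> [i Ki|i Ki].
  by rewrite -aD DE (negbTE Ki) mulr0.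
have aM : a *m M = e *m D by rewrite /a mulmxKV.
have : (a *m M) 0 i = (e *m D) 0 i by rewrite aM.
rewrite DE Ki mulr1 => <-; rewrite /M /E mulmxDr mulmxBr mulmx1 aD subrr addr0.
by rewrite !mulmxA aD DE Ki mulr1.
Qed.

End positive_definite.

(** * Conditional probabilities and conditional independence in integrated form *)

Section conditional_independence.
Context (R : realType) (disp : measure_display) (T : measurableType disp)
  (P : probability T R).
Implicit Types (G : set (set T)) (A B : set T) (f g h u : T -> R).

Local Notation integrable u := (P.-integrable setT (EFin \o u)).

Definition sub_sigma_field G := sigma_algebra setT G /\ G `<=` measurable.

Definition measurable_for G (f : T -> R) :=
  measurable_fun setT (f : g_sigma_algebraType G -> R).

(** The annihilator of this family consists of the integrable u with E(u | G) = 0. *)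
Definition indicators G : set (T -> R) := [set h | exists2 A, G A & h = \1_A].

Lemma indicators_bounded G h : sub_sigma_field G -> indicators G h ->
  bounded_measurable h.
Proof. by move=> [_ Gm] [A GA ->]; apply: bounded_measurable_indic; exact: Gm. Qed.

Lemma indicators1 G : sub_sigma_field G -> indicators G (cst 1).
Proof.
move=> [sG _]; exists setT; last by rewrite indicT.
by rewrite -(measurable_g_measurableTypeE sG); exact: measurableT.
Qed.

Lemma sub_sigma_fieldI G A B : sub_sigma_field G -> G A -> G B -> G (A `&` B).
Proof.
move=> [sG _]; rewrite -(measurable_g_measurableTypeE sG); exact: measurableI.
Qed.

Lemma multiplier_indicators G A : sub_sigma_field G -> G A ->
  measurable A /\ multiplier P (indicators G) \1_A.
Proof.
move=> [sG Gm] GA; split; first exact: Gm.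
have bA : bounded_measurable (\1_A : T -> R) by apply: bounded_measurable_indic; exact: Gm.
split => // u [iu Gu]; split; first exact: integrable_mul.
move=> _ [B GB ->].
have GBA : indicators G \1_(B `&` A).
  by exists (B `&` A) => //; exact: sub_sigma_fieldI.
by rewrite -[RHS](Gu _ GBA) indicI; apply: eq_Rintegral => w _ /=; rewrite mulrA.
Qed.

Lemma annihilator_indicators G h u : sub_sigma_field G ->
  annihilator P (indicators G) u -> measurable_for G h ->
  (exists K, forall w, `|h w| <= K) -> \int[P]_w (h w * u w) = 0.
Proof.
move=> sG Gu mh bh; apply: (annihilator_mul (indicators1 sG) _ Gu).
apply: (@multiplier_measurable _ _ _ _ _ _ G) => //.
- by move=> ?; exact: indicators_bounded.
- exact: sG.1.
- by move=> ?; exact: multiplier_indicators.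
Qed.

Lemma measurable_forW G h : sub_sigma_field G -> measurable_for G h ->
  measurable_fun setT h.
Proof.
move=> [sG Gm] mh _ B mB; apply: Gm.
by rewrite -(measurable_g_measurableTypeE sG); exact: mh.
Qed.

Lemma measurable_for_indic G A : sub_sigma_field G -> G A -> measurable_for G \1_A.
Proof.
move=> [sG _] GA; apply: (@measurable_indic _ (g_sigma_algebraType G)).
by rewrite (measurable_g_measurableTypeE sG).
Qed.

(** The set {g < f} belongs to G. Tested on it, the hypothesis bounds the integral of a nonnegative
    function by 0, so that function vanishes almost everywhere. *)
Lemma ae_le_sub_sigma_field G f g : sub_sigma_field G ->
  measurable_for G f -> measurable_for G g -> integrable f -> integrable g ->
  (forall E, G E -> \int[P]_w (\1_E w * f w) <= \int[P]_w (\1_E w * g w)) ->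
  {ae P, forall w, f w <= g w}.
Proof.
move=> sG mf mg if_ ig fg.
pose N := [set w | g w < f w].
have GN : G N.
  have := measurable_funB mf mg measurableT (measurable_itv `]0, +oo[).
  rewrite setTI (_ : _ @^-1` _ = N) => [|]; last first.
    by apply/seteqP; split => w; rewrite /N /= in_itv/= andbT subr_gt0.
  by rewrite [X in X N](measurable_g_measurableTypeE sG.1).
have bN := indicators_bounded sG (ex_intro2 _ _ N GN erefl).
have i1 := integrable_mul bN if_; have i2 := integrable_mul bN ig.
have k0 w : 0 <= \1_N w * f w - \1_N w * g w.
  rewrite -mulrBr indicE; case: (boolP (w \in N)) => [/set_mem /= gf|_];
    last by rewrite mul0r.
  by rewrite mul1r subr_ge0 ltW.
have : (\int[P]_w `|(\1_N w * f w - \1_N w * g w)%:E| = 0)%E.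
  have i := integrableB measurableT i1 i2.
  under eq_integral do rewrite /= ger0_norm//.
  have fin := integrable_fin_num measurableT i.
  apply/eqP; rewrite eq_le; apply/andP; split; last first.
    by apply: integral_ge0 => w _; rewrite lee_fin.
  rewrite -[leLHS]fineK//.
  rewrite lee_fin [leLHS](_ : _ = \int[P]_w (\1_N w * f w - \1_N w * g w))//.
  by rewrite RintegralB// subr_le0 fg.
move=> /(ae_eq_integral_abs P measurableT) H.
have : ae_eq P setT (fun w => (\1_N w * f w - \1_N w * g w)%:E) (cst 0%E).
  apply: H; apply/measurable_EFinP; apply: measurable_funB.
    by apply: measurable_funM; [exact: bN.1|exact: measurable_forW mf].
  by apply: measurable_funM; [exact: bN.1|exact: measurable_forW mg].
apply: filterS => w /(_ Logic.I) [].
rewrite -mulrBr indicE leNgt; case: (boolP (w \in N)) => [_|/negP nN _].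
  by rewrite mul1r => /eqP; rewrite subr_eq0 => /eqP ->; rewrite ltxx.
by apply/negP => gf; apply: nN; exact/mem_set.
Qed.

Lemma ae_eq_sub_sigma_field G f g : sub_sigma_field G ->
  measurable_for G f -> measurable_for G g -> integrable f -> integrable g ->
  (forall E, G E -> \int[P]_w (\1_E w * f w) = \int[P]_w (\1_E w * g w)) ->
  {ae P, forall w, f w = g w}.
Proof.
move=> sG mf mg if_ ig fg.
have H1 : {ae P, forall w, f w <= g w}.
  by apply: (ae_le_sub_sigma_field sG) => // E GE; rewrite fg.
have H2 : {ae P, forall w, g w <= f w}.
  by apply: (ae_le_sub_sigma_field sG) => // E GE; rewrite fg.
by apply: filterS2 H1 H2 => w h1 h2; apply/eqP; rewrite eq_le h1.
Qed.

Lemma Rintegral_indicM A B : measurable A -> measurable B ->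
  \int[P]_w (\1_A w * \1_B w) = fine (P (A `&` B)).
Proof.
move=> mA mB; rewrite /Rintegral.
under eq_integral do rewrite -[X in X%:E]/((\1_A \* \1_B) _) -indicI.
by rewrite integral_indic ?setIT//; exact: measurableI.
Qed.

Lemma Rintegral_in A f : \int[P]_(w in A) f w = \int[P]_w (\1_A w * f w).
Proof.
by rewrite Rintegral_mkcond patch_indic; apply: eq_Rintegral => w _; rewrite mulrC.
Qed.

(** Rephrases the defining integrals over sets of [G] as an orthogonality relation, to which the
    theory of multipliers applies. *)
Lemma cprob_versionP G A f : sub_sigma_field G -> measurable A ->
  cprob_version P G A f <-> [/\ measurable_for G f, integrable f &
    annihilator P (indicators G) (fun w => \1_A w - f w)].
Proof.
move=> sG mA.
have iA : integrable (\1_A) by exact: integrable_indic.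
have eqv E : G E -> integrable f ->
    \int[P]_w (\1_E w * (\1_A w - f w)) =
    fine (P (A `&` E)) - \int[P]_(w in E) f w.
  move=> GE if_; have bE := indicators_bounded sG (ex_intro2 _ _ E GE erefl).
  under eq_Rintegral do rewrite mulrBr.
  rewrite RintegralB//; [|exact: (integrable_mul bE iA)|exact: (integrable_mul bE if_)].
  have mE := sG.2 _ GE.
  by rewrite Rintegral_indicM// setIC (Rintegral_in E).
split=> [[mf if_ fE]|[mf if_ [_ Gu]]]; split=> //.
  split; first exact: (integrableB measurableT iA if_).
  by move=> _ [E GE ->]; rewrite eqv// /Rintegral fE// subrr.
move=> E GE; have mE := sG.2 _ GE.
have /eqP := Gu _ (ex_intro2 _ _ E GE erefl); rewrite eqv// subr_eq0 => /eqP.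
have fin : (\int[P]_(w in E) (f w)%:E)%E \is a fin_num.
  by apply: integrable_fin_num => //; exact: (integrableS measurableT).
by move=> e; rewrite -(fineK fin) -[RHS]fineK ?fin_num_measure//;
  [rewrite e|exact: measurableI].
Qed.

(** The chosen version lies in [0, 1] only almost surely, whereas multipliers must be bounded
    everywhere; clipping it changes it on a null set and keeps it G-measurable. *)
Lemma cprob_bounded_version G A : sub_sigma_field G -> measurable A ->
  exists q, [/\ cprob_version P G A q, (forall w, 0 <= q w <= 1) &
    {ae P, forall w, cprob P G A w = q w}].
Proof.
move=> sG mA; pose f := cprob P G A.
have vf : cprob_version P G A f by apply: cprobP => //; [exact: sG.1|exact: sG.2].
have /(cprob_versionP _ sG mA)[mf if_ [_ Gf]] := vf.
have iA : integrable (\1_A) by exact: integrable_indic.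
have fE E : G E -> \int[P]_w (\1_E w * f w) = \int[P]_w (\1_E w * \1_A w).
  move=> GE; have bE := indicators_bounded sG (ex_intro2 _ _ E GE erefl).
  have /eqP := Gf _ (ex_intro2 _ _ E GE erefl).
  under eq_Rintegral do rewrite mulrBr.
  rewrite RintegralB//; [|exact: (integrable_mul bE iA)|exact: (integrable_mul bE if_)].
  by rewrite subr_eq0 => /eqP.
have A01 w : 0 <= (\1_A w : R) <= 1 by rewrite indicE; case: (_ \in _);
  rewrite ?lexx ?ler01.
have icst r : integrable (cst r).
  by apply: bounded_measurable_integrable; exact: bounded_measurable_cst.
have mono E g g' : G E -> integrable g -> integrable g' -> (forall w, g w <= g' w) ->
    \int[P]_w (\1_E w * g w) <= \int[P]_w (\1_E w * g' w).
  move=> GE ig ig' gg; have bE := indicators_bounded sG (ex_intro2 _ _ E GE erefl).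
  apply: le_Rintegral => //;
    [exact: (integrable_mul bE ig)|exact: (integrable_mul bE ig')|].
  by move=> w _; rewrite ler_wpM2l// indicE ler0n.
have H0 : {ae P, forall w, cst 0 w <= f w}.
  apply: (ae_le_sub_sigma_field sG) => //; first exact: measurable_cst.
  by move=> E GE; rewrite fE//; apply: mono => // w; case/andP: (A01 w).
have H1 : {ae P, forall w, f w <= cst 1 w}.
  apply: (ae_le_sub_sigma_field sG) => //; first exact: measurable_cst.
  by move=> E GE; rewrite fE//; apply: mono => // w; case/andP: (A01 w).
pose q w := Num.max 0 (Num.min (f w) 1).
have fq : {ae P, forall w, f w = q w}.
  by apply: filterS2 H0 H1 => w /= h0 h1; rewrite /q (min_idPl h1) (max_idPr h0).
have q01 w : 0 <= q w <= 1.
  by rewrite /q le_max lexx/= ge_max ler01/= ge_min lexx orbT.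
have mq : measurable_for G q.
  by apply: measurable_maxr; [exact: measurable_cst|apply: measurable_minr => //;
    exact: measurable_cst].
exists q; split=> //; apply/cprob_versionP => //.
have bq : bounded_measurable q.
  split; first exact: measurable_forW mq.
  by exists 1 => w; have /andP[q0 q1] := q01 w; rewrite ger0_norm.
have iq := bounded_measurable_integrable P bq.
split=> //; split; first exact: (integrableB measurableT iA iq).
move=> _ [E GE ->]; rewrite -[RHS](Gf _ (ex_intro2 _ _ E GE erefl)).
have mE := (indicators_bounded sG (ex_intro2 _ _ E GE erefl)).1.
rewrite /Rintegral; congr fine; apply: ae_eq_integral => //.
- by apply/measurable_EFinP; apply: measurable_funM => //; apply: measurable_funB;
  [exact: measurable_indic|exact: bq.1].
- by apply/measurable_EFinP; apply: measurable_funM => //; apply: measurable_funB;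
  [exact: measurable_indic|exact: measurable_forW mf].
- by apply: filterS fq => w + _; rewrite -/f => ->.
Qed.

Lemma ae_eq_Rintegral f g : measurable_fun setT f -> measurable_fun setT g ->
  {ae P, forall w, f w = g w} -> \int[P]_w f w = \int[P]_w g w.
Proof.
move=> mf mg fg; rewrite /Rintegral; congr fine; apply: ae_eq_integral => //.
- exact/measurable_EFinP.
- exact/measurable_EFinP.
- by apply: filterS fg => w -> _.
Qed.

(* The asymmetric form of conditional independence: a conditional probability
   of B given G is also one given G and H. *)
Lemma cond_indep_annihilator G H B q : sub_sigma_field G ->
  sub_sigma_field H -> measurable B ->
  cprob_version P G B q -> (forall w, 0 <= q w <= 1) ->
  (forall A, H A -> {ae P, forall w,
    cprob P G (A `&` B) w = cprob P G A w * cprob P G B w}) <->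
  annihilator P (indicators <<s G `|` H >>) (fun w => \1_B w - q w).
Proof.
move=> sG sH mB vq q01.
have ind01 A w : `|\1_A w : R| <= 1 by rewrite indicE ger0_norm ?ler0n// lern1 leq_b1.
have bnd q' : (forall w, 0 <= q' w <= 1) -> exists K, forall w : T, `|q' w : R| <= K.
  by move=> q'01; exists 1 => w; have /andP[? ?] := q'01 w; rewrite ger0_norm.
have /(cprob_versionP _ sG mB)[mq iq Gq] := vq.
have bq : bounded_measurable q by split; [exact: measurable_forW mq|exact: bnd].
have iu : integrable (fun w => \1_B w - q w) := Gq.1.
have iB : integrable (\1_B) by exact: integrable_indic.
(* A bounded version p of P(A | G). Since q is bounded and G-measurable, 1_A may be replaced by p in
   integrals against 1_E q. *)
have versions A : H A -> exists p, [/\ measurable_for G p, bounded_measurable p,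
    (forall E, G E -> \int[P]_w (\1_E w * \1_A w * q w) = \int[P]_w (\1_E w * (p w * q
      w))) &
    {ae P, forall w, cprob P G A w * cprob P G B w = p w * q w}].
  move=> HA; have mA := sH.2 _ HA.
  have [p [vp p01 ap]] := cprob_bounded_version sG mA.
  have /(cprob_versionP _ sG mA)[mp ip Gp] := vp.
  have bp : bounded_measurable p by split; [exact: measurable_forW mp|exact: bnd].
  have [q' [vq' q'01 aq']] := cprob_bounded_version sG mB.
  have /(cprob_versionP _ sG mB)[mq' iq' Gq'] := vq'.
  (* [cprob P G B] is chosen independently of [q]; the two are linked through the bounded version
     [q']. *)
  have qq' : {ae P, forall w, q w = q' w}.
    apply: (ae_eq_sub_sigma_field sG) => // E GE.
    have bE := indicators_bounded sG (ex_intro2 _ _ E GE erefl).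
    have := Gq'.2 _ (ex_intro2 _ _ E GE erefl).
    rewrite -(Gq.2 _ (ex_intro2 _ _ E GE erefl)).
    under eq_Rintegral do rewrite mulrBr.
    under [RHS]eq_Rintegral do rewrite mulrBr.
    have i1 := integrable_mul bE iB.
    rewrite RintegralB//; last exact: (integrable_mul bE iq').
    rewrite RintegralB//; last exact: (integrable_mul bE iq).
    by move=> /addrI /oppr_inj.
  exists p; split=> //.
    move=> E GE; have bE := indicators_bounded sG (ex_intro2 _ _ E GE erefl).
    have bA := bounded_measurable_indic R mA.
    have : \int[P]_w ((\1_E \* q) w * (\1_A w - p w)) = 0.
      apply: (annihilator_indicators sG Gp).
        by apply: measurable_funM => //; exact: measurable_for_indic.
      by exists (1 * 1) => w /=; have /andP[? ?] := q01 w;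
        rewrite normrM ler_pM// ger0_norm.
    under eq_Rintegral do rewrite mulrBr.
    have ib g : bounded_measurable g -> integrable (\1_E \* q \* g).
      move=> bg; apply: bounded_measurable_integrable.
      by apply: bounded_measurableM => //; exact: bounded_measurableM.
    rewrite RintegralB//; [|exact: ib|exact: ib] => /eqP; rewrite subr_eq0 => /eqP e.
    transitivity (\int[P]_w ((\1_E \* q) w * \1_A w)).
      by apply: eq_Rintegral => w _ /=; ring.
    by rewrite e; apply: eq_Rintegral => w _ /=; ring.
  by apply: filterS3 ap aq' qq' => w -> -> ->.
have mI A : H A -> measurable (A `&` B) by move=> /sH.2 mA; exact: measurableI.
split=> [CI|[_ GHu] A HA].
(* These products are the indicators of a family of intersections generating the sigma-field of [G]
   and [H]; it suffices to annihilate them and to show that indicators of sets of [G] and of [H] are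
   multipliers. *)
- pose F : set (T -> R) := [set h | exists A E, [/\ H A, G E & h = \1_A \* \1_E]].
  have bF h : F h -> bounded_measurable h.
    move=> [A [E [HA GE ->]]]; apply: bounded_measurableM; apply: bounded_measurable_indic.
      exact: sH.2.
    exact: sG.2.
  have Hset : H setT by rewrite -(measurable_g_measurableTypeE sH.1); exact: measurableT.
  have Gset : G setT by rewrite -(measurable_g_measurableTypeE sG.1); exact: measurableT.
  have Fu : annihilator P F (fun w => \1_B w - q w).
    split=> // _ [A [E [HA GE ->]]].
    have [p [mp bp pq apq]] := versions _ HA.
    have mA := sH.2 _ HA; have mE := sG.2 _ GE.
    have bA := bounded_measurable_indic R mA.
    have bE := bounded_measurable_indic R mE.
    have bB := bounded_measurable_indic R mB.
    have ib g g' g'' : bounded_measurable g -> bounded_measurable g' ->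
      bounded_measurable g'' ->
        integrable (g \* g' \* g'').
      by move=> *; apply: bounded_measurable_integrable;
        do 2! [apply: bounded_measurableM => //].
    under eq_Rintegral do rewrite mulrBr.
    rewrite RintegralB//; [|exact: ib|exact: ib].
    apply/eqP; rewrite subr_eq0; apply/eqP.
    (* E(1_E 1_A 1_B) = E(1_E P(A B | G)) = E(1_E p q) = E(1_E 1_A q), the middle equality being
       conditional independence. *)
    transitivity (\int[P]_w (\1_E w * (p w * q w))); last first.
      by rewrite -pq//; apply: eq_Rintegral => w _ /=; ring.
    have vAB : cprob_version P G (A `&` B) (cprob P G (A `&` B)).
      by apply: cprobP; [exact: sG.1|exact: sG.2|exact: mI].
    have /(cprob_versionP _ sG (mI _ HA))[mAB iAB GAB] := vAB.
    transitivity (\int[P]_w (\1_E w * cprob P G (A `&` B) w)); last first.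
      apply: ae_eq_Rintegral.
      + by apply: measurable_funM; [exact: bE.1|exact: measurable_forW mAB].
      + by apply: measurable_funM; [exact: bE.1|apply: measurable_funM;
        [exact: bp.1|exact: bq.1]].
      + by apply: filterS2 (CI _ HA) apq => w -> ->.
    have := GAB.2 _ (ex_intro2 _ _ E GE erefl).
    under eq_Rintegral do rewrite mulrBr.
    have iAB' : integrable (\1_(A `&` B)) by apply: integrable_indic; exact: mI.
    rewrite RintegralB//; [|exact: (integrable_mul bE iAB')|exact: (integrable_mul bE iAB)].
    move=> /eqP; rewrite subr_eq0 => /eqP <-; apply: eq_Rintegral => w _.
    by rewrite indicI /=; ring.
  have mult D : <<s G `|` H >> D -> measurable D /\ multiplier P F \1_D.
    apply: (sub_multiplier_indic bF) => {}D [GD|HD].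
    + split; first exact: sG.2.
      split; first by apply: bounded_measurable_indic; exact: sG.2.
      move=> u [iu' Fu']; split.
        by apply: integrable_mul => //; apply: bounded_measurable_indic; exact: sG.2.
      move=> _ [A [E [HA GE ->]]].
      have FED : F (\1_A \* \1_(E `&` D)).
        by exists A, (E `&` D); split => //; exact: sub_sigma_fieldI.
      rewrite -[RHS](Fu' _ FED); apply: eq_Rintegral => w _.
      by rewrite indicI /=; ring.
    + split; first exact: sH.2.
      split; first by apply: bounded_measurable_indic; exact: sH.2.
      move=> u [iu' Fu']; split.
        by apply: integrable_mul => //; apply: bounded_measurable_indic; exact: sH.2.
      move=> _ [A [E [HA GE ->]]].
      have FED : F (\1_(A `&` D) \* \1_E).
        by exists (A `&` D), E; split => //; exact: sub_sigma_fieldI.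
      rewrite -[RHS](Fu' _ FED); apply: eq_Rintegral => w _.
      by rewrite indicI /=; ring.
  split=> // _ [D /mult[_ FD] ->]; apply: (annihilator_mul _ FD Fu).
  by exists setT, setT; split => //; rewrite !indicT; apply/funext => w /=; rewrite mulr1.
- have [p [mp bp pq apq]] := versions _ HA.
  have mA := sH.2 _ HA.
  have vAB : cprob_version P G (A `&` B) (cprob P G (A `&` B)).
    by apply: cprobP; [exact: sG.1|exact: sG.2|exact: mI].
  have /(cprob_versionP _ sG (mI _ HA))[mAB iAB GAB] := vAB.
  suff : {ae P, forall w, cprob P G (A `&` B) w = p w * q w}.
    by move=> h; apply: filterS2 h apq => w -> ->.
  apply: (ae_eq_sub_sigma_field sG) => //.
  + exact: measurable_funM.
  + by apply: bounded_measurable_integrable; exact: bounded_measurableM.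
  move=> E GE; have mE := sG.2 _ GE.
  have bA := bounded_measurable_indic R mA.
  have bE := bounded_measurable_indic R mE.
  have bB := bounded_measurable_indic R mB.
  (* The converse runs through the same equalities, the hypothesis now being tested on the
     intersection of A and E. *)
  have GHD : <<s G `|` H >> (A `&` E).
    have sGH : sigma_algebra setT <<s G `|` H >> by exact: smallest_sigma_algebra.
    rewrite -(measurable_g_measurableTypeE sGH).
    apply: measurableI; rewrite (measurable_g_measurableTypeE sGH).
      by apply: sub_sigma_algebra; right.
    by apply: sub_sigma_algebra; left.
  have := GHu _ (ex_intro2 _ _ _ GHD erefl).
  under eq_Rintegral do rewrite indicI mulrBr.
  have ib g g' g'' : bounded_measurable g -> bounded_measurable g' -> bounded_measurable
    g'' ->
      integrable (g \* g' \* g'').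
    by move=> *; apply: bounded_measurable_integrable;
      do 2! [apply: bounded_measurableM => //].
  rewrite RintegralB//; [|exact: ib|exact: ib] => /eqP; rewrite subr_eq0 => /eqP e.
  rewrite -pq//; transitivity (\int[P]_w ((\1_A \* \1_E) w * q w)); last first.
    by apply: eq_Rintegral => w _ /=; ring.
  rewrite -e; have := GAB.2 _ (ex_intro2 _ _ E GE erefl).
  under eq_Rintegral do rewrite mulrBr.
  have iAB' : integrable (\1_(A `&` B)) by apply: integrable_indic; exact: mI.
  rewrite RintegralB//; [|exact: (integrable_mul bE iAB')|exact: (integrable_mul bE iAB)].
  move=> /eqP; rewrite subr_eq0 => /eqP <-; apply: eq_Rintegral => w _.
  by rewrite indicI /=; ring.
Qed.

End conditional_independence.

(** * Linear combinations of a Gaussian vector *)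

Section gaussian_vectors.
Context (R : realType) (disp : measure_display) (T : measurableType disp)
  (P : probability T R) (n : nat) (X : 'I_n -> T -> R).
Hypothesis mX : forall i, measurable_fun setT (X i).

Local Notation integrable u := (P.-integrable setT (EFin \o u)).

Definition lincomb (a : 'rV[R]_n) (w : T) : R := \sum_i a 0 i * X i w.

Definition gaussian_vector : Prop := forall a : 'rV[R]_n, exists m s : R,
  forall B : set R, measurable B -> P (lincomb a @^-1` B) = gaussian_law m s B.

Hypothesis gX : gaussian_vector.

Definition cov : 'M[R]_n := \matrix_(i, j) fine (covariance P (X i) (X j)).

Lemma measurable_lincomb a : measurable_fun setT (lincomb a).
Proof. by apply: measurable_sum => i; exact: measurable_funM. Qed.

Lemma lincombD a b w : lincomb (a + b) w = lincomb a w + lincomb b w.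
Proof. by rewrite -big_split; apply: eq_bigr => i _; rewrite mxE mulrDl. Qed.

Lemma lincombZ r a w : lincomb (r *: a) w = r * lincomb a w.
Proof. by rewrite mulr_sumr; apply: eq_bigr => i _; rewrite mxE mulrA. Qed.

Lemma lincombB a b w : lincomb (a - b) w = lincomb a w - lincomb b w.
Proof. by rewrite -scaleN1r lincombD lincombZ mulN1r. Qed.

Lemma lincomb_delta i w : lincomb (delta_mx 0 i) w = X i w.
Proof.
rewrite /lincomb (bigD1 i)//= big1 ?addr0 => [|j ji].
  by rewrite mxE !eqxx mul1r.
by rewrite mxE eqxx (negbTE ji) mul0r.
Qed.

Definition lincomb_mean (a : 'rV[R]_n) : R := \int[P]_w lincomb a w.

(** Replaces the law by the integrals needed later; [s] enters only through its square, the
    variance. *)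
Lemma gaussian_lincomb a : exists s,
  [/\ integrable (lincomb a),
      integrable (fun w => (lincomb a w - lincomb_mean a) ^+ 2),
      \int[P]_w (lincomb a w - lincomb_mean a) ^+ 2 = s ^+ 2 &
      forall t, \int[P]_w cos (lincomb a w + t) =
        cos (lincomb_mean a + t) * expR (- (s ^+ 2 / 2))].
Proof.
have [m [s law]] := gX a.
have ma : @measurable_fun _ _ T (measurableTypeR R) setT (lincomb a) :=
  measurable_lincomb a.
pose Y : {RV P >-> measurableTypeR R} := @mfun_Sub _ _ T (measurableTypeR R) (lincomb a)
  (mem_set ma).
have lawY : forall B : set R, measurable B -> P (Y @^-1` B) = gaussian_law m s B by [].
have mE : lincomb_mean a = m := gaussian_law_mean lawY.
have [i2 e2] := gaussian_law_second_moment lawY.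
exists s; rewrite mE; split => //.
- exact: (gaussian_law_integrable lawY).
- exact: (gaussian_law_cos lawY).
Qed.

Let mean i := \int[P]_w X i w.

Lemma integrable_coordinate i : integrable (X i).
Proof.
have [s [h _ _ _]] := gaussian_lincomb (delta_mx 0 i).
by move: h; rewrite (_ : lincomb _ = X i)//; apply/funext => w; rewrite lincomb_delta.
Qed.

(** The squares are integrable by the Gaussian law of each coordinate, and |p q| <= p^2 + q^2. *)
Lemma integrable_coordinate_prod i j :
  integrable (fun w => (X i w - mean i) * (X j w - mean j)).
Proof.
have sq k : integrable (fun w => (X k w - mean k) ^+ 2).
  have [s [_ h _ _]] := gaussian_lincomb (delta_mx 0 k).
  move: h; rewrite /lincomb_mean (_ : lincomb _ = X k)//.
  by apply/funext => w; rewrite lincomb_delta.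
have mc k : measurable_fun setT (fun w => X k w - mean k) by exact: measurable_funB.
apply: le_integrable (integrableD measurableT (sq i) (sq j)) => //.
  by apply/measurable_EFinP; exact: measurable_funM.
move=> w _; rewrite lee_fin; apply: le_trans (ler_norm _).
rewrite normrM -(real_normK (num_real (X i w - mean i))) -(real_normK (num_real (X j w -
  mean j))).
move: `|_| `|_| (normr_ge0 (X i w - mean i)) (normr_ge0 (X j w - mean j)) => p q p0 q0.
by have := sqr_ge0 (p - q); nra.
Qed.

Lemma covE i j : cov i j = \int[P]_w ((X i w - mean i) * (X j w - mean j)).
Proof.
by rewrite mxE; rewrite unlock [in X in _ = X]/Rintegral; congr fine; rewrite unlock.
Qed.

Lemma Rintegral_sum (I : Type) (r : seq I) (f : I -> T -> R) :
  (forall i, integrable (f i)) ->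
  integrable (fun w => \sum_(i <- r) f i w) /\
  \int[P]_w (\sum_(i <- r) f i w) = \sum_(i <- r) \int[P]_w f i w.
Proof.
move=> fi; elim: r => [|i r [ih1 ih2]].
  split; last by rewrite big_nil; under eq_Rintegral do rewrite big_nil;
    rewrite Rintegral_cst// mul0r.
  under eq_fun do rewrite big_nil.
  by apply: bounded_measurable_integrable; exact: bounded_measurable_cst.
split; first by under eq_fun do rewrite big_cons;
  exact: (integrableD measurableT (fi i) ih1).
rewrite big_cons -ih2 -RintegralD//.
by apply: eq_Rintegral => w _; rewrite big_cons.
Qed.

Lemma lincomb_meanE a : lincomb_mean a = \sum_i a 0 i * mean i.
Proof.
have h i : integrable (fun w => a 0 i * X i w).
  exact: (integrableZl measurableT _ (integrable_coordinate i)).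
rewrite /lincomb_mean /lincomb (Rintegral_sum _ h).2; apply: eq_bigr => i _.
by rewrite RintegralZl//; exact: integrable_coordinate.
Qed.

Lemma lincomb_variance a :
  \int[P]_w (lincomb a w - lincomb_mean a) ^+ 2 = (a *m cov *m a^T) 0 0.
Proof.
have ip i j := integrable_coordinate_prod i j.
have izp i j : integrable (fun w => a 0 i * a 0 j * ((X i w - mean i) * (X j w - mean j))).
  exact: (integrableZl measurableT _ (ip i j)).
transitivity (\int[P]_w \sum_i \sum_j a 0 i * a 0 j * ((X i w - mean i) * (X j w - mean
  j))).
  apply: eq_Rintegral => w _; rewrite lincomb_meanE /lincomb -sumrB expr2 mulr_suml.
  apply: eq_bigr => i _; rewrite mulr_sumr; apply: eq_bigr => j _; ring.
rewrite (Rintegral_sum _ (fun i => (Rintegral_sum _ (izp i)).1)).2.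
rewrite [RHS]mxE.
under [RHS]eq_bigr do rewrite mxE mulr_suml.
rewrite [RHS]exchange_big/=; apply: eq_bigr => i _.
rewrite (Rintegral_sum _ (izp i)).2; apply: eq_bigr => j _.
have aT : a^T j 0 = a 0 j by rewrite mxE.
by rewrite RintegralZl// -covE aT; ring.
Qed.

Lemma lincomb_cos a t : \int[P]_w cos (lincomb a w + t) =
  cos (lincomb_mean a + t) * expR (- ((a *m cov *m a^T) 0 0 / 2)).
Proof.
by have [s [_ _ <- ->]] := gaussian_lincomb a; rewrite lincomb_variance.
Qed.

Lemma cov_sym : cov^T = cov.
Proof. by apply/matrixP => i j; rewrite !mxE covarianceC. Qed.

(** The quadratic form of [cov] is a variance, hence nonnegative. *)
Lemma cov_posdef : cov \in unitmx -> posdefmx cov.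
Proof.
apply: psdmx_unit_posdef; first exact: cov_sym.
by move=> v; rewrite -lincomb_variance Rintegral_ge0// => w _; exact: sqr_ge0.
Qed.

Implicit Types K S U L : pred 'I_n.

Definition sigma_coord K : set (set T) :=
  <<s \bigcup_(i in [set i | K i]) preimage_set_system setT (X i) measurable >>.

Lemma sigma_coord_sub K : sub_sigma_field (sigma_coord K).
Proof.
split; first exact: smallest_sigma_algebra.
apply: smallest_sub; first exact: sigma_algebra_measurable.
by move=> E [i _ [B mB <-]]; exact: mX.
Qed.

Lemma sigma_coordS K L : (forall i, K i -> L i) -> sigma_coord K `<=` sigma_coord L.
Proof.
move=> KL; apply: smallest_sub; first exact: smallest_sigma_algebra.
by move=> E [i Ki hE]; apply: sub_sigma_algebra; exists i => //; exact: KL.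
Qed.

Lemma sigma_coordU S U :
  <<s sigma_coord S `|` sigma_coord U >> = sigma_coord (predU S U).
Proof.
apply/seteqP; split; apply: smallest_sub; try exact: smallest_sigma_algebra.
  by move=> E [SE|UE]; [apply: sigma_coordS SE|apply: sigma_coordS UE] => i /= ->;
    rewrite ?orbT.
move=> E [i /= /orP SUi hE]; apply: sub_sigma_algebra.
by case: SUi => Ki; [left|right]; apply: sub_sigma_algebra; exists i.
Qed.

Definition supported K (a : 'rV[R]_n) := forall i, ~~ K i -> a 0 i = 0.

Lemma measurable_for_lincomb K a : supported K a ->
  measurable_for (sigma_coord K) (lincomb a).
Proof.
move=> Ka; apply: (@measurable_sum _ (g_sigma_algebraType (sigma_coord K))) => i.
have [Ki|nKi] := boolP (K i); last first.
  by rewrite (Ka _ nKi); under eq_fun do rewrite mul0r; exact: measurable_cst.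
apply: measurable_funM; first exact: measurable_cst.
move=> _ B mB; rewrite (measurable_g_measurableTypeE (sigma_coord_sub K).1).
by apply: sub_sigma_algebra; exists i => //; exists B.
Qed.

Lemma measurable_for_cos K a t : supported K a ->
  measurable_for (sigma_coord K) (fun w => cos (lincomb a w + t)).
Proof.
move=> Ka.
have ml : measurable_for (sigma_coord K) (fun w => lincomb a w + t).
  by apply: measurable_funD; [exact: measurable_for_lincomb|exact: measurable_cst].
exact: (bounded_measurable_cos ml).1.
Qed.

Definition lincombs K : set (T -> R) := [set y | exists2 a, supported K a & y = lincomb a].

(** The uniqueness theorem for the linear space [lincombs K], which contains the coordinates in [K]
    and so generates at least [sigma_coord K]. *)
Lemma annihilator_cosines K u : annihilator P (cosines (lincombs K)) u ->
  annihilator P (indicators (sigma_coord K)) u.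
Proof.
move=> Fu; split; first exact: Fu.1.
have mV y : lincombs K y -> measurable_fun setT y.
  by move=> [a _ ->]; exact: measurable_lincomb.
have V0 : lincombs K (cst 0).
  exists 0; first by move=> i _; rewrite mxE.
  by apply/funext => w; rewrite /lincomb big1// => i _; rewrite mxE mul0r.
have VD y z : lincombs K y -> lincombs K z -> lincombs K (y \+ z).
  move=> [a Ka ->] [b Kb ->]; exists (a + b).
    by move=> i Ki; rewrite mxE Ka// Kb// addr0.
  by apply/funext => w; rewrite lincombD.
have VZ r y : lincombs K y -> lincombs K (fun w => r * y w).
  move=> [a Ka ->]; exists (r *: a); first by move=> i Ki; rewrite mxE Ka// mulr0.
  by apply/funext => w; rewrite lincombZ.
have sub : sigma_coord K `<=`
    <<s \bigcup_(y in lincombs K) preimage_set_system setT y measurable >>.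
  apply: smallest_sub; first exact: smallest_sigma_algebra.
  move=> E [i Ki hE]; apply: sub_sigma_algebra; exists (X i) => //.
  exists (delta_mx 0 i); last by apply/funext => w; rewrite lincomb_delta.
  by move=> j nKj; rewrite mxE eqxx; case: eqP => // ji; move: nKj; rewrite ji Ki.
move=> _ [D KD ->].
have [_ FD] := cosines_sigma_algebra P mV VD VZ (sub _ KD).
exact: (annihilator_mul (cosines1 V0) FD Fu).
Qed.

Lemma lincomb_meanD (a b : 'rV[R]_n) : lincomb_mean (a + b) = lincomb_mean a +
  lincomb_mean b.
Proof.
rewrite !lincomb_meanE -big_split; apply: eq_bigr => i _.
by rewrite mxE mulrDl.
Qed.

Lemma lincomb_meanB (a b : 'rV[R]_n) : lincomb_mean (a - b) = lincomb_mean a -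
  lincomb_mean b.
Proof.
rewrite !lincomb_meanE -sumrB; apply: eq_bigr => i _.
by rewrite !mxE mulrBl.
Qed.

Lemma cov_formC (a b : 'rV[R]_n) : (b *m cov *m a^T) 0 0 = (a *m cov *m b^T) 0 0.
Proof.
transitivity ((b *m cov *m a^T)^T 0 0); first by rewrite [RHS]mxE.
by rewrite !trmx_mul trmxK cov_sym mulmxA.
Qed.

Let addE (A B : 'M[R]_1) : (A + B) 0 0 = A 0 0 + B 0 0.
Proof. by rewrite mxE. Qed.

Let oppE (A : 'M[R]_1) : (- A) 0 0 = - A 0 0.
Proof. by rewrite mxE. Qed.

Lemma cov_formD (a b : 'rV[R]_n) : ((b + a) *m cov *m (b + a)^T) 0 0 =
  (b *m cov *m b^T) 0 0 + (a *m cov *m a^T) 0 0 + (a *m cov *m b^T) 0 0 *+ 2.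
Proof.
rewrite linearD/= !mulmxDl !mulmxDr !addE (cov_formC a b); ring.
Qed.

Lemma cov_formB (a b : 'rV[R]_n) : ((b - a) *m cov *m (b - a)^T) 0 0 =
  (b *m cov *m b^T) 0 0 + (a *m cov *m a^T) 0 0 - (a *m cov *m b^T) 0 0 *+ 2.
Proof.
rewrite linearB/= !mulmxBl !mulmxBr !(addE, oppE) (cov_formC a b); ring.
Qed.

(* Uncorrelated linear combinations of a Gaussian vector are independent. *)
Lemma annihilator_uncorrelated K a t : (forall i, K i -> (a *m cov) 0 i = 0) ->
  annihilator P (indicators (sigma_coord K))
    (fun w => cos (lincomb a w + t) - \int[P]_w cos (lincomb a w + t)).
Proof.
move=> aK; apply: annihilator_cosines.
have bc b s : bounded_measurable (fun w => cos (lincomb b w + s)).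
  apply: (bounded_measurable_cos (f := fun w => lincomb b w + s)).
  by apply: measurable_funD => //; exact: measurable_lincomb.
have ic b s := bounded_measurable_integrable P (bc b s).
set e := \int[P]_w _.
have ie : integrable (cst e).
  by apply: bounded_measurable_integrable; exact: bounded_measurable_cst.
split; first exact: (integrableB measurableT (ic a t) ie).
move=> _ [_ [s [[b Kb ->] ->]]].
under eq_Rintegral do rewrite mulrBr.
rewrite RintegralB//;
  [|exact: (integrable_mul (bc b s) (ic a t))|exact: (integrable_mul (bc b s) ie)].
rewrite RintegralZr//.
have ab0 : (a *m cov *m b^T) 0 0 = 0.
  rewrite mxE big1// => i _; have [Ki|nKi] := boolP (K i); first by rewrite aK// mul0r.
  by rewrite [b^T _ _]mxE Kb// mulr0.
transitivity (\int[P]_w (2^-1 * (cos (lincomb (b + a) w + (s + t)) +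
    cos (lincomb (b - a) w + (s - t)))) - \int[P]_w cos (lincomb b w + s) * e).
  congr (_ - _); apply: eq_Rintegral => w _; rewrite lincombD lincombB.
  rewrite (_ : lincomb b w + lincomb a w + (s + t) = (lincomb b w + s) + (lincomb a w +
    t)); last by ring.
  rewrite (_ : lincomb b w - lincomb a w + (s - t) = (lincomb b w + s) - (lincomb a w +
    t)); last by ring.
  by rewrite (cosD (lincomb b w + s)) (cosB (lincomb b w + s)); field.
rewrite RintegralZl//; last exact: (integrableD measurableT (ic _ _) (ic _ _)).
rewrite RintegralD// /e !lincomb_cos lincomb_meanD lincomb_meanB.
(* Without correlation, b + a and b - a have the same variance vb + va; the exponential factors out
   and the two cosines recombine into the product of the expectations. *)
rewrite cov_formD cov_formB ab0 mul0rn subr0 addr0.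
set mb := lincomb_mean b; set ma := lincomb_mean a.
set vb := (b *m cov *m b^T) 0 0; set va := (a *m cov *m a^T) 0 0.
rewrite (_ : mb + ma + (s + t) = (mb + s) + (ma + t)); last by ring.
rewrite (_ : mb - ma + (s - t) = (mb + s) - (ma + t)); last by ring.
rewrite (_ : - ((vb + va) / 2) = - (vb / 2) + - (va / 2)); last by field.
rewrite expRD; move: (mb + s) (ma + t) => p q.
by rewrite cosD cosB; field.
Qed.

(** * Zero blocks of the precision matrix and conditional independence *)

Section precision_matrix.
Variables S U L : pred 'I_n.
Hypothesis covU : cov \in unitmx.
Hypothesis SU0 : forall i, U i -> ~~ S i.
Hypothesis SUL : forall i, L i = ~~ (S i || U i).

(** A combination b of x_S and x_U is split as a + (b - a), where a = e C^-1 with e supported on U.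
    Then a C = e makes a uncorrelated with x_S and x_L, while b - a involves x_S only. After the
    addition formula, each term is the mean of a function of a times the mean of a function of x_S
    against 1_B - q, and the latter is zero. *)
Lemma cov_precision_zero_annihilator B q :
  (forall i j, U i -> L j -> invmx cov i j = 0) -> bounded_measurable q ->
  measurable B -> annihilator P (indicators (sigma_coord S)) (fun w => \1_B w - q w) ->
  sigma_coord L B -> measurable_for (sigma_coord S) q ->
  annihilator P (indicators (sigma_coord (predU S U))) (fun w => \1_B w - q w).
Proof.
move=> prec0 bq mB Su LB mq.
have bu : bounded_measurable (fun w => \1_B w - q w).
  have := bounded_measurableD (bounded_measurable_indic R mB)
    (bounded_measurableM (bounded_measurable_cst T (-1)) bq).
  by congr bounded_measurable; apply/funext => w /=; rewrite mulN1r.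
apply: annihilator_cosines; split; first exact: Su.1.
move=> _ [_ [t [[b SUb ->] ->]]].
(* The U block of C^-1 is invertible, so e can be chosen to make a agree with b on U; on L, a
   vanishes by the zero block. *)
have [e [eU eb]] := posdefmx_solve U b (posdefmx_inv (cov_posdef covU)).
set a := e *m invmx cov in eb.
have aC : a *m cov = e by rewrite /a mulmxKV.
have aL i : L i -> a 0 i = 0.
  move=> Li; rewrite mxE big1// => j _; have [Uj|nUj] := boolP (U j).
    by rewrite prec0// mulr0.
  by rewrite eU// mul0r.
have bS : supported S (b - a).
  move=> i nSi; rewrite mxE [(- a) 0 i]mxE; have [Ui|nUi] := boolP (U i).
    by rewrite eb// subrr.
  have nSU : ~~ predU S U i by rewrite /= negb_or nSi.
  by rewrite (SUb _ nSU) aL ?subrr// SUL.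
pose g r w := cos (lincomb (b - a) w + r) * (\1_B w - q w).
have Sg r : \int[P]_w g r w = 0.
  apply: (annihilator_indicators (sigma_coord_sub S) Su).
    exact: measurable_for_cos.
  by exists 1 => w; rewrite ler_norml cos_geN1 cos_le1.
have bcos c r : bounded_measurable (fun w => cos (lincomb c w + r)).
  apply: (bounded_measurable_cos (f := fun w => lincomb c w + r)).
  by apply: measurable_funD => //; exact: measurable_lincomb.
have bg r : bounded_measurable (g r) by exact: bounded_measurableM.
have indep r s : \int[P]_w (cos (lincomb a w + s) * g r w) = 0.
  have ann := @annihilator_uncorrelated (predU S L) a s.
  have aSL i : predU S L i -> (a *m cov) 0 i = 0.
    rewrite aC /= SUL => h; apply: eU; apply: contraTN h => Ui.
    by rewrite Ui orbT orbF; exact: SU0.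
  have mg : measurable_for (sigma_coord (predU S L)) (g r).
    apply: measurable_funM.
      by apply: measurable_for_cos => i /=; rewrite negb_or => /andP[nS _]; exact: bS.
    apply: measurable_funB.
      apply: measurable_for_indic; first exact: sigma_coord_sub.
      by apply: sigma_coordS LB => i /= ->; rewrite orbT.
    move=> _ D mD; rewrite (measurable_g_measurableTypeE (sigma_coord_sub (predU S L)).1).
    apply: (@sigma_coordS S) => [i /= ->//|].
    by rewrite -(measurable_g_measurableTypeE (sigma_coord_sub S).1); exact: mq.
  have := annihilator_indicators (sigma_coord_sub _) (ann aSL) mg (bg r).2.
  set E := \int[P]_w cos (lincomb a w + s) => H.
  transitivity (\int[P]_w (g r w * (cos (lincomb a w + s) - E) + g r w * E)).
    by apply: eq_Rintegral => w _; ring.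
  have ig := bounded_measurable_integrable P (bg r).
  have i1 := integrable_mul (bg r) (ann aSL).1.
  have ie : integrable (cst E).
    by apply: bounded_measurable_integrable; exact: bounded_measurable_cst.
  rewrite RintegralD//; last exact: (integrable_mul (bg r) ie).
  by rewrite H add0r RintegralZr// Sg mul0r.
(* The sine terms of the addition formula are written as cosines with phase -pi/2, so that [indep]
   handles both products. *)
transitivity (\int[P]_w (cos (lincomb a w + 0) * g t w -
    cos (lincomb a w + (- (pi / 2))) * g (t - pi / 2) w)).
  apply: eq_Rintegral => w _; rewrite /g.
  rewrite (_ : lincomb b w + t = lincomb a w + (lincomb (b - a) w + t)); last first.
    by rewrite lincombB; ring.
  rewrite (addrA (lincomb (b - a) w) t); move: (lincomb (b - a) w + t) => y; rewrite addr0.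
  have sE (z : R) : cos (z - pi / 2) = sin z.
    by rewrite cosB cos_pihalf sin_pihalf mulr0 mulr1 add0r.
  by rewrite !sE cosD; ring.
have ic r s : integrable (fun w => cos (lincomb a w + s) * g r w).
  apply: bounded_measurable_integrable; exact: bounded_measurableM.
by rewrite RintegralB// !indep subrr.
Qed.

(** Sines of the centred combinations serve as bounded substitutes for the combinations. For h the
    sine of a, E(h 1_B) = E(h (1_B - q)) + E(h q): the first term vanishes by conditional
    independence, the second because h is centred and independent of x_S. Hence h is orthogonal to
    the sine of the centred x_l. *)
Lemma cond_indep_uncorrelated a l :
  (forall B, sigma_coord L B -> exists q, [/\ measurable_for (sigma_coord S) q,
    exists M : R, forall w, `|q w| <= M &
    annihilator P (indicators (sigma_coord (predU S U))) (fun w => \1_B w - q w)]) ->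
  supported (predU S U) a -> (forall i, S i -> (a *m cov) 0 i = 0) -> L l ->
  (a *m cov) 0 l = 0.
Proof.
move=> CI SUa aS Ll.
have bcos c r : bounded_measurable (fun w => cos (lincomb c w + r)).
  apply: (bounded_measurable_cos (f := fun w => lincomb c w + r)).
  by apply: measurable_funD => //; exact: measurable_lincomb.
have icst r : integrable (cst r).
  by apply: bounded_measurable_integrable; exact: bounded_measurable_cst.
(* This phase turns the cosine into the sine of the centred combination, which has mean zero. *)
pose t := - lincomb_mean a - pi / 2.
pose h w := cos (lincomb a w + t).
have cos_pi2 : cos (- (pi / 2)) = 0 :> R by rewrite cosN cos_pihalf.
have Eh : \int[P]_w h w = 0.
  by rewrite /h lincomb_cos /t addrA subrr add0r cos_pi2 mul0r.
have ih : integrable h := bounded_measurable_integrable P (bcos a t).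
have annL : annihilator P (indicators (sigma_coord L)) h.
  split=> // _ [B LB ->]; have [q [mq bq SUu]] := CI _ LB.
  have mB := (sigma_coord_sub L).2 _ LB.
  have bq' : bounded_measurable q.
    by split => //; apply: measurable_forW mq; exact: sigma_coord_sub.
  have e1 : \int[P]_w (h w * (\1_B w - q w)) = 0.
    apply: (annihilator_indicators (sigma_coord_sub _) SUu).
      exact: measurable_for_cos.
    by exists 1 => w; rewrite ler_norml cos_geN1 cos_le1.
  have e2 : \int[P]_w (q w * h w) = 0.
    have ann := @annihilator_uncorrelated S a t aS.
    have : \int[P]_w (q w * (h w - \int[P]_w h w)) = 0.
      exact: (annihilator_indicators (sigma_coord_sub S) ann mq bq).
    rewrite Eh => e; rewrite -[RHS]e.
    by apply: eq_Rintegral => w _; rewrite subr0.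
  transitivity (\int[P]_w (h w * (\1_B w - q w) + q w * h w)).
    by apply: eq_Rintegral => w _; ring.
  rewrite RintegralD ?e1 ?e2 ?addr0//.
    exact: (integrable_mul (bcos a t) SUu.1).
  exact: (integrable_mul bq' ih).
set b : 'rV[R]_n := delta_mx 0 l.
have Lb : supported L b.
  by move=> j nLj; rewrite mxE eqxx; case: eqP => // jl; move: nLj; rewrite jl Ll.
pose s := - lincomb_mean b - pi / 2.
have e0 : \int[P]_w (cos (lincomb b w + s) * h w) = 0.
  apply: (annihilator_indicators (sigma_coord_sub L) annL).
    exact: measurable_for_cos.
  by exists 1 => w; rewrite ler_norml cos_geN1 cos_le1.
have : \int[P]_w (2^-1 * (cos (lincomb (b + a) w + (s + t)) +
    cos (lincomb (b - a) w + (s - t)))) = 0.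
  rewrite -[RHS]e0; apply: eq_Rintegral => w _; rewrite /h lincombD lincombB.
  rewrite (_ : lincomb b w + lincomb a w + (s + t) = (lincomb b w + s) + (lincomb a w +
    t)); last by ring.
  rewrite (_ : lincomb b w - lincomb a w + (s - t) = (lincomb b w + s) - (lincomb a w +
    t)); last by ring.
  by rewrite (cosD (lincomb b w + s)) (cosB (lincomb b w + s)); field.
have ic b' s' := bounded_measurable_integrable P (bcos b' s').
rewrite RintegralZl//; last exact: (integrableD measurableT (ic _ _) (ic _ _)).
rewrite RintegralD// !lincomb_cos lincomb_meanD lincomb_meanB cov_formD cov_formB.
rewrite (_ : lincomb_mean b + lincomb_mean a + (s + t) = - pi); last first.
  by rewrite /s /t; field.
rewrite (_ : lincomb_mean b - lincomb_mean a + (s - t) = 0); last first.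
  by rewrite /s /t; field.
(* With v the sum of the two variances, what remains is exp(-(v - 2k)/2) = exp(-(v + 2k)/2), whence
   k = 0. *)
rewrite cosN cospi cos0; set k := (a *m cov *m b^T) 0 0.
have kE : k = (a *m cov) 0 l.
  by rewrite /k trmx_delta -colE mxE.
move=> /eqP; rewrite mulf_eq0 invr_eq0 pnatr_eq0/= mulN1r mul1r addrC subr_eq0.
move=> /eqP /expR_inj; rewrite -kE; lra.
Qed.

(** For necessity, let a be supported on S and U with a C equal to the i-th unit vector there. The
    preceding lemma extends the equality to L, so a is row i of C^-1, and it has no entry in L. *)
Lemma cond_indep_precision :
  (forall A B, sigma_coord U A -> sigma_coord L B -> {ae P, forall w,
    cprob P (sigma_coord S) (A `&` B) w =
    cprob P (sigma_coord S) A w * cprob P (sigma_coord S) B w}) <->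
  (forall i j, U i -> L j -> invmx cov i j = 0).
Proof.
have sS := sigma_coord_sub S; have sU := sigma_coord_sub U.
have version B : sigma_coord L B -> exists q,
    [/\ cprob_version P (sigma_coord S) B q, forall w, 0 <= q w <= 1 &
    exists M : R, forall w, `|q w| <= M].
  move=> LB; have mB := (sigma_coord_sub L).2 _ LB.
  have [q [vq q01 _]] := cprob_bounded_version P sS mB.
  exists q; split=> //; exists 1 => w.
  by have /andP[q0 q1] := q01 w; rewrite ger0_norm.
split=> [CI i j Ui Lj|prec0 A B UA LB].
- have [a [aSU aE]] := posdefmx_solve (predU S U) (delta_mx 0 i) (cov_posdef covU).
  have CI' B : sigma_coord L B -> exists q, [/\ measurable_for (sigma_coord S) q,
      exists M : R, forall w, `|q w| <= M &
      annihilator P (indicators (sigma_coord (predU S U))) (fun w => \1_B w - q w)].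
    move=> LB; have mB := (sigma_coord_sub L).2 _ LB.
    have [q [vq q01 bq]] := version _ LB.
    exists q; split=> //; first by case: vq.
    rewrite -sigma_coordU; apply/(cond_indep_annihilator sS sU mB vq q01) => A UA.
    exact: CI.
  have aS k : S k -> (a *m cov) 0 k = 0.
    move=> Sk; rewrite aE /= ?Sk// mxE eqxx; case: eqP => // ki.
    by move: (SU0 Ui); rewrite -ki Sk.
  have aC : a *m cov = delta_mx 0 i.
    apply/rowP => k; have [SUk|nSUk] := boolP (predU S U k); first exact: aE.
    have Lk : L k by rewrite SUL.
    rewrite (cond_indep_uncorrelated CI' aSU aS Lk) mxE eqxx; case: eqP => // ki.
    by move: nSUk; rewrite /= ki Ui orbT.
  have -> : invmx cov i j = a 0 j.
    by rewrite -[a](mulmxK covU) aC -rowE mxE.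
  by rewrite aSU//= -SUL.
- have mB := (sigma_coord_sub L).2 _ LB.
  have [q [vq q01 bq]] := version _ LB.
  apply: (cond_indep_annihilator sS sU mB vq q01).2 UA.
  have /(cprob_versionP P q sS mB)[mq iq Su] := vq.
  rewrite sigma_coordU; apply: cov_precision_zero_annihilator => //.
  by split => //; exact: measurable_forW mq.
Qed.

End precision_matrix.

End gaussian_vectors.

(** * From blocks of random vectors to scalar coordinates *)

Section block_coordinates.
Context (R : realType) (disp : measure_display) (T : measurableType disp)
  (P : probability T R) (N d : nat) (x : 'I_N.+1 -> {RV P >-> d.-tuple R}).

Local Notation n := (\sum_(k < N.+1) d)%N.
Local Notation block := (@tagnat.sig1 N.+1 (fun=> d)).

Definition coordinate (s : 'I_n) (w : T) : R :=
  tnth (x (block s) w) (@tagnat.sig2 N.+1 (fun=> d) s).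

Lemma measurable_coordinate s : measurable_fun setT (coordinate s).
Proof.
by move/measurable_fun_tnthP : (measurable_funPT (x (block s))); exact.
Qed.

Lemma covmx_coordinate : covmx x = cov P coordinate.
Proof. by apply/matrixP => s t; rewrite !mxE. Qed.

Lemma gaussian_coordinate : jointly_gaussian x -> gaussian_vector P coordinate.
Proof.
move=> gx a.
have [m [s law]] := gx (fun k i => a 0 (@tagnat.Rank N.+1 (fun=> d) k i)).
exists m, s => B mB; rewrite -law//; congr (P (_ @^-1` B)).
apply/funext => w; rewrite sig_big_dep/= (reindex _ tagnat.sig_bij_on)/=.
by apply: eq_bigr => t _;
  rewrite -[tagnat.Rank _ _]/(tagnat.Rank (block t) (tagnat.sig2 t)) tagnat.sig2K.
Qed.

(** A map into tuples is measurable exactly when its components are. *)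
Lemma sigma_seq_coordinate (K : set 'I_N.+1) (p : pred 'I_N.+1) :
  (forall k, K k <-> p k) ->
  sigma_seq x K = sigma_coord coordinate (fun s => p (block s)).
Proof.
move=> Kp; apply/seteqP; split; apply: smallest_sub; try exact: smallest_sigma_algebra.
- move=> E [k /Kp pk [B mB <-]].
  have sC : sigma_algebra setT (sigma_coord coordinate (fun s => p (block s))).
    exact: smallest_sigma_algebra.
  have : measurable_fun setT
      (x k : g_sigma_algebraType (sigma_coord coordinate (fun s => p (block s))) ->
        d.-tuple R).
    apply/measurable_fun_tnthP => i D A mA.
    rewrite [X in X _](measurable_g_measurableTypeE sC); apply: sub_sigma_algebra.
    pose s := @tagnat.Rank N.+1 (fun=> d) k i.
    exists s; first by rewrite /= /s tagnat.Rank1K.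
    exists A => //; congr (_ `&` (_ @^-1` A)); apply/funext => w.
    (* The inner index of a rank is recovered only up to a cast along the equality of blocks, so
       indices are compared by their values. *)
    have tE k' (i' : 'I_d) : k' = k -> val i' = val i -> tnth (x k' w) i' = tnth (x k w) i.
      by move=> -> /val_inj ->.
    by apply: tE; rewrite ?tagnat.Rank1K// tagnat.Rank2K.
  by move=> /(_ measurableT _ mB); rewrite [X in X _](measurable_g_measurableTypeE sC).
- move=> E [s /= ps [A mA <-]]; apply: sub_sigma_algebra.
  exists (block s); first exact/Kp.
  exists ((fun t : d.-tuple R => tnth t (@tagnat.sig2 N.+1 (fun=> d) s)) @^-1` A) => //.
  by rewrite -[X in measurable X]setTI; exact: measurable_tnth.
Qed.

End block_coordinates.

(** Treats both matrix forms at once, as a condition on the indices other than c. Blocks above and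
    below some j are at distance at least 2; conversely two such indices have some j strictly
    between them, and symmetry of C^-1 settles their order. *)
Lemma CM_precision (R : realType) (disp : measure_display)
    (T : measurableType disp) (P : probability T R) (N d : nat)
    (x : 'I_N.+1 -> {RV P >-> d.-tuple R}) (c : 'I_N.+1) :
  jointly_gaussian x -> covmx x \in unitmx ->
  CM x c <-> forall i k : 'I_N.+1, i != c -> k != c -> (1 < `|i - k|)%N ->
    submxblock (invmx (covmx x)) i k = 0.
Proof.
move=> gx; rewrite covmx_coordinate => uC.
have gX := gaussian_coordinate gx; have mX := measurable_coordinate x.
have symI s t : invmx (cov P (coordinate x)) s t = invmx (cov P (coordinate x)) t s.
  by rewrite -[in LHS]cov_sym -trmx_inv mxE.
pose block := @tagnat.sig1 N.+1 (fun=> d).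
have sepE (j : 'I_N.+1) :
  (forall A B : set T,
    sigma_seq x [set k : 'I_N.+1 | (j < k)%N /\ k <> c] A ->
    sigma_seq x [set k : 'I_N.+1 | (k < j)%N /\ k <> c] B ->
    {ae P, forall w,
      cprob P (sigma_seq x [set j; c]) (A `&` B) w =
      cprob P (sigma_seq x [set j; c]) A w * cprob P (sigma_seq x [set j; c]) B w}) <->
  (forall s t, (j < block s)%N && (block s != c) -> (block t < j)%N && (block t != c) ->
    invmx (cov P (coordinate x)) s t = 0).
  rewrite (@sigma_seq_coordinate _ _ _ _ _ _ x [set k : 'I_N.+1 | (j < k)%N /\ k <> c]
    (fun k => (j < k)%N && (k != c))); last first.
    by move=> k; split=> [[-> /eqP//]|/andP[? /eqP ?]].
  rewrite (@sigma_seq_coordinate _ _ _ _ _ _ x [set k : 'I_N.+1 | (k < j)%N /\ k <> c]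
    (fun k => (k < j)%N && (k != c))); last first.
    by move=> k; split=> [[-> /eqP//]|/andP[? /eqP ?]].
  rewrite (@sigma_seq_coordinate _ _ _ _ _ _ x [set j; c]
    (fun k => (k == j) || (k == c))); last first.
    by move=> k; split=> [[->|->]|/orP[/eqP->|/eqP->]]; rewrite ?eqxx ?orbT//; [left|right].
  apply: cond_indep_precision => //.
    move=> s /andP[js sc]; rewrite negb_or sc andbT.
    by apply: contraTneq js => ->; rewrite ltnn.
  move=> s; rewrite -/block; case: (eqVneq (block s) c) => sc;
    rewrite ?orbT ?andbF//= !andbT !orbF.
  by rewrite negb_or -leqNgt ltn_neqAle.
split=> [CMx i k ic kc ik|prec0 j].
- apply/matrixP => p q; rewrite !mxE.
  set s := tagnat.Rank i p; set t := tagnat.Rank k q.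
  have bs : block s = i by exact: tagnat.Rank1K.
  have bt : block t = k by exact: tagnat.Rank1K.
  have key (i' k' : 'I_N.+1) (s' t' : 'I_(\sum_(k < N.+1) d)) :
      block s' = i' -> block t' = k' -> i' != c -> k' != c -> (k'.+1 < i')%N ->
      invmx (cov P (coordinate x)) s' t' = 0.
    move=> bs' bt' i'c k'c ki'.
    have kN : (k'.+1 < N.+1)%N by apply: ltn_trans ki' (ltn_ord i').
    (* The separating index is j = k' + 1, which lies strictly below i'. *)
    apply: (sepE (Ordinal kN)).1; first exact: CMx.
      by rewrite bs' i'c andbT.
    by rewrite bt' k'c andbT /=.
  have [ki|ik'] := ltnP k i.
    by apply: (key _ _ _ _ bs bt) => //; move: ik; lia.
  by rewrite symI; apply: (key _ _ _ _ bt bs) => //; move: ik; lia.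
- apply: (sepE j).2 => s t /andP[js sc] /andP[tj tc].
  have /matrixP/(_ (tagnat.sig2 s) (tagnat.sig2 t)) :
      submxblock (invmx (cov P (coordinate x))) (block s) (block t) = 0.
    by apply: prec0 => //; lia.
  by rewrite !mxE !tagnat.sig2K.
Qed.

Theorem theorem4p2 (R : realType) (disp : measure_display)
    (T : measurableType disp) (P : probability T R) (N d : nat)
    (x : 'I_N.+1 -> {RV P >-> d.-tuple R}) (c : 'I_N.+1)
    (hc : c = ord0 \/ c = ord_max)
    (hgauss : jointly_gaussian x)
    (hnonsing : covmx x \in unitmx) :
  CM x c <-> CM_form c (invmx (covmx x)).
Proof.
have pd : posdefmx (invmx (covmx x)).
  apply: posdefmx_inv; rewrite covmx_coordinate in hnonsing *.
  apply: cov_posdef hnonsing; first exact: measurable_coordinate.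
  exact: gaussian_coordinate.
have maxE (i : 'I_N.+1) : (i < N)%N = (i != ord_max).
  by rewrite -val_eqE/= ltn_neqAle -ltnS ltn_ord andbT.
have minE (i : 'I_N.+1) : (0 < i)%N = (i != ord0).
  by rewrite -val_eqE/= lt0n.
(* The index range in each matrix form is the set of indices different from c, so both implications
   of [CM_form] reduce to the same block condition; for N = 0 both premises hold at once. *)
rewrite (CM_precision c hgauss hnonsing); split=> [prec0|[HL HF] i k ic kc].
  by split=> c_eq; split=> // i k; rewrite ?maxE ?minE -c_eq; exact: prec0.
case: hc => c_eq.
  by apply: (HF c_eq).2; rewrite minE -c_eq.
by apply: (HL c_eq).2; rewrite maxE -c_eq.
Qed.
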